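(* Let $N>2$ be an integer, $d:=\lceil\sqrt{\log N}\rceil$ and $X:=d^{1000d}$. Let $\mathbf{b}_1,\dots,\mathbf{b}_d$ be i.i.d. random variables, each uniformly distributed in the set of primes $\le X$ not dividing $N$. Let $r\ge 0$ and let $\mathbf{x}_1,\dots,\mathbf{x}_r$ be arbitrary random variables taking values in $(\mathbb{Z}/N\mathbb{Z})^\times$ (not assumed independent of each other, of the $\mathbf{b}_i$, or identically distributed). Then, with probability $1+O(d^{-d})$, the lattice $$\mathcal{L}:=\Big\{(e_1,\dots,e_d,f_1,\dots,f_r)\in\mathbb{Z}^{d+r}:\ \prod_{i=1}^d\mathbf{b}_i^{e_i}\prod_{i=1}^r\mathbf{x}_i^{f_i}\equiv 1\pmod N\Big\}$$ has a basis consisting of vectors of Euclidean norm $\ll e^{42(d+r)}$.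
   Context: Implied constants in $O(\cdot)$ and $\ll$ are absolute. $\log$ is the natural logarithm. *)

(* Defs.v *)
From HB Require Import structures.
From mathcomp Require Import all_boot all_order all_algebra.
From mathcomp Require Import all_classical all_reals all_analysis.

Set Implicit Arguments.
Unset Strict Implicit.
Unset Printing Implicit Defensive.

Import Order.TTheory GRing.Theory Num.Theory.
Import numFieldNormedType.Exports.

Local Open Scope classical_set_scope.
Local Open Scope ring_scope.

HB.instance Definition _ (R : finUnitRingType) :=
  isPointed.Build {unit R} 1%g.

(* Finite unit groups, such as (Z/NZ)^*, carry the discrete sigma-algebra. *)
HB.instance Definition _ (R : finUnitRingType) :=
  @isMeasurable.Build default_measure_display {unit R}
    discrete_measurable discrete_measurable0
    discrete_measurableC discrete_measurableU.

Definition dim_of (R : realType) (N : nat) : nat :=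
  `|Num.ceil (Num.sqrt (ln (N%:R : R)))|%N.

Definition primes_upto_not_dvd (N X : nat) : seq nat :=
  [seq p <- iota 0 X.+1 | prime p && ~~ (p %| N)%N].

(* Only the law is prescribed: Y may leave s on a null event. *)
Definition uniform_on (R : realType) (d : measure_display)
    (T : measurableType d) (P : probability T R)
    (Y : {RV P >-> nat}) (s : seq nat) : Prop :=
  forall p : nat,
    P (Y @^-1` [set p]) = (if p \in s then (size s)%:R^-1 else 0)%:E.

Definition mutually_independent (R : realType) (d d' : measure_display)
    (T : measurableType d) (T' : measurableType d') (P : probability T R)
    (I : finType) (Y : I -> {RV P >-> T'}) : Prop :=
  forall (J : {set I}) (A : I -> set T'), (forall i, measurable (A i)) ->
    P (\bigcap_(i in [set` J]) (Y i @^-1` A i)) =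
    (\prod_(i in J) P (Y i @^-1` A i))%E.

(* A vector of Z^(d+r) lists (e_1, .., e_d, f_1, .., f_r). Inversion in 'Z_N
   is the identity on non-units, so negative exponents are meaningful only
   when every b i is coprime to N. *)
Definition relation_lattice (N d r : nat)
    (b : 'I_d -> nat) (x : 'I_r -> {unit 'Z_N}) : set 'rV[int]_(d + r) :=
  [set v | (\prod_(i < d) ((b i)%:R : 'Z_N) ^ v ord0 (lshift r i)) *
           (\prod_(j < r) (val (x j) : 'Z_N) ^ v ord0 (rshift d j)) = 1].

(* The rows of B form a Z-basis of L. *)
Definition is_lattice_basis (k n : nat) (L : set 'rV[int]_n)
    (B : 'M[int]_(k, n)) : Prop :=
  (forall c : 'rV[int]_k, c *m B = 0 -> c = 0) /\
  L = range (fun c : 'rV[int]_k => c *m B).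

(* The library norm on matrices is the sup norm. *)
Definition euclidean_norm (R : realType) (n : nat) (v : 'rV[int]_n) : R :=
  Num.sqrt (\sum_(j < n) (v ord0 j)%:~R ^+ 2).

Definition has_basis_of_norm_le (R : realType) (n : nat)
    (L : set 'rV[int]_n) (M : R) : Prop :=
  exists (k : nat) (B : 'M[int]_(k, n)),
    is_lattice_basis L B /\ forall i, euclidean_norm R (row i B) <= M.

(* Main.v *)
(* No zero-density estimate is needed. A set of lattice vectors M e_i - u_i, with
   nonnegative u_i and M large compared with the entries of all u_i, is independent
   by diagonal dominance and can be refined to a basis of comparable size. Such
   vectors exist as soon as every element of the subgroup H generated by the b_i
   and x_j is a product of powers of them with exponents e^{O(d)}. By Fourier
   inversion this holds unless some character chi, nontrivial on H, maps all the
   b_i and x_j to within e^{-O(d)} of 1; such a chi has order > K = 3^{20 d}, since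
   a root of unity of small order is either 1 or far from 1. Hence it suffices to
   bound, over all chi of order > K, the probability that all chi(b_i) are near 1.

   Let S(chi) be the sum of chi(p) over the primes p considered, and choose k such
   that X^k is just above N. Counting the solutions of p_1..p_k = q_1..q_k mod N
   shows that the 2k-th moment of S over all characters is almost as small as the
   contribution of the trivial character. The number of p with chi(p) near 1 is
   controlled, through the Fejer kernel, by the energy T_K(chi), the sum of
   |S(chi^j)|^2 for 1 <= j <= K. After replacing chi by a suitable power, no
   dilation h > 1 captures too much of this energy, so a positive proportion of
   T_K^4 comes from quadruples of exponents with gcd 1. As chi is determined by
   four powers with coprime exponents, the moment bound for S becomes a moment
   bound for T_K, which makes the union bound affordable when T_K is not too large.
   It is never too large: the powers of a chi of order > K are distinct, so the
   moment bound applies to them as well. *)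
From mathcomp Require Import all_boot all_order all_algebra all_fingroup.
From mathcomp Require Import all_solvable all_field all_character.
From mathcomp Require Import boolp zify ring lra.

Set Implicit Arguments.
Unset Strict Implicit.
Unset Printing Implicit Defensive.

(** * Chebyshev's lower bound and the numerical parameters *)

Lemma expn2_le_central_bin n : 2 ^ n <= 'C(n + n, n).
Proof.
rewrite -(binomial.Vandermonde n n n) -[2]/(1 + 1) expnDn; apply: leq_sum => i _.
have le_in : i <= n by rewrite -ltnS.
by rewrite !exp1n !muln1 bin_sub // leq_pmulr // bin_gt0.
Qed.

Lemma sum_leq_indicator e m : \sum_(1 <= k < m.+1) (k <= e) <= e.
Proof.
have [le_me|lt_em] := leqP m e.
  apply: leq_trans (_ : \sum_(1 <= k < m.+1) 1 <= e).
    by apply: leq_sum => k _; apply: leq_b1.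
  by rewrite sum_nat_const_nat muln1 subn1.
rewrite (@big_cat_nat _ _ _ e.+1 1 m.+1) ?ltnS ?(ltnW lt_em) //=.
rewrite [X in _ + X]big1_seq ?addn0 => [|k].
  apply: leq_trans (_ : \sum_(1 <= k < e.+1) 1 <= e).
    by apply: leq_sum => k _; apply: leq_b1.
  by rewrite sum_nat_const_nat muln1 subn1.
by rewrite mem_index_iota => /andP[_ /andP[ek _]]; rewrite leqNgt ek.
Qed.

(** By Legendre's formula each power [p ^ k] adds at most 1 to the exponent of [p] (a carry in
    [n + n]), and nothing once [p ^ k] exceeds [n + n]. *)
Lemma logn_central_bin p n : prime p -> 0 < n ->
  p ^ logn p 'C(n + n, n) <= n + n.
Proof.
move=> pr_p n_gt0; have p1 := prime_gt1 pr_p.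
have nn_gt0 : 0 < n + n by rewrite addn_gt0 n_gt0.
apply: leq_trans (trunc_logP p1 nn_gt0); rewrite leq_pexp2l ?prime_gt0 //.
set e := trunc_log p (n + n).
have := congr1 (logn p) (bin_fact (leq_addr n n)).
rewrite addnK lognM ?bin_gt0 ?leq_addr ?muln_gt0 ?fact_gt0 //.
rewrite lognM ?fact_gt0 // => logE.
rewrite -(leq_add2r (logn p n`! + logn p n`!)) logE.
have wide : logn p n`! = \sum_(1 <= k < (n + n).+1) n %/ p ^ k.
  rewrite logn_fact // (@big_cat_nat _ _ _ n.+1 1 (n + n).+1) //=; last first.
    by rewrite ltnS leq_addr.
  rewrite [X in _ = _ + X]big1_seq ?addn0 // => k.
  rewrite mem_index_iota => /andP[_ /andP[nk _]].
  by rewrite divn_small // (leq_trans nk) // ltnW // ltn_expl.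
apply: leq_trans (leq_add (sum_leq_indicator e (n + n)) (leqnn _)).
rewrite logn_fact // wide -!big_split /=; apply: leq_sum => k _.
rewrite divnD ?expn_gt0 ?prime_gt0 // addnC leq_add2r.
have [le_pk|//] := leqP (p ^ k) (n %% p ^ k + n %% p ^ k).
rewrite (_ : k <= e) //; apply: trunc_log_max => //.
by apply: leq_trans le_pk _; rewrite leq_add ?leq_mod.
Qed.

Lemma central_bin_le n (s : seq nat) : 0 < n ->
  (forall p, prime p -> p <= n + n -> p \in s) ->
  2 ^ n <= (n + n) ^ size s.
Proof.
move=> n_gt0 s_primes; apply: leq_trans (expn2_le_central_bin n) _.
have C_gt0 : 0 < 'C(n + n, n) by rewrite bin_gt0 leq_addr.
have nn_gt0 : 0 < n + n by rewrite addn_gt0 n_gt0.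
rewrite {1}(prod_prime_decomp C_gt0) prime_decompE big_map /=.
apply: leq_trans (_ : \prod_(p <- primes 'C(n + n, n)) (n + n) <= _).
  rewrite big_seq [leqRHS]big_seq; apply: leq_prod => p.
  by rewrite mem_primes => /andP[pr_p _]; apply: logn_central_bin.
rewrite big_const_seq count_predT iter_muln_1 leq_pexp2l //.
apply: uniq_leq_size (primes_uniq _) _ => p pC.
have := pC; rewrite mem_primes => /andP[pr_p _]; apply: s_primes => //.
apply: leq_trans (logn_central_bin pr_p n_gt0).
by rewrite -{1}[p]expn1 (leq_pexp2l (prime_gt0 pr_p)) // logn_gt0.
Qed.

Lemma expn2_size_primes N : 0 < N -> 2 ^ size (primes N) <= N.
Proof.
move=> N_gt0; rewrite [leqRHS](prod_prime_decomp N_gt0) prime_decompE big_map /=.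
apply: leq_trans (_ : \prod_(p <- primes N) 2 <= _).
  by rewrite big_const_seq count_predT iter_muln_1.
rewrite big_seq [leqRHS]big_seq; apply: leq_prod => p pN.
have := pN; rewrite mem_primes => /andP[pr_p _].
apply: leq_trans (prime_gt1 pr_p) _.
by rewrite -{1}[p]expn1 (leq_pexp2l (prime_gt0 pr_p)) // logn_gt0.
Qed.

Section NumericalBounds.

Context (d : nat).
Hypothesis d_large : 2 ^ 12 <= d.

Let l := trunc_log 2 d.
(* [X ^ k] is at least [N] by [modulus_le_power], and [k * l] is a small
   fraction of [d]. *)
Let k := (d %/ (500 * l)).+1.
Let X := d ^ (1000 * d).

Let d_gt0 : 0 < d. Proof. by apply: leq_trans d_large; rewrite expn_gt0. Qed.
Let l_ge12 : 12 <= l. Proof. exact: trunc_log_max. Qed.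
Let le_2l : 2 ^ l <= d. Proof. exact: trunc_logP. Qed.
Let lt_2l : d < 2 ^ l.+1. Proof. exact: trunc_log_ltn. Qed.

Lemma mul_trunc_log_le : 12 * l <= d.
Proof.
apply: leq_trans le_2l; have := l_ge12.
elim: (l) => // n IHn; rewrite leq_eqVlt => /orP[/eqP<- //|].
by rewrite ltnS => /[dup] n12 /IHn; rewrite expnS; lia.
Qed.

(** This and the next two lemmas supply the hypotheses [le_d], [le_Q], [le_q] of the count of bad
    tuples, for [m = l + 9], [v = 2 * (k * d ^ 3) ^ k], [q = 9 ^ d] and [Q = 3 ^ (5 * d)]. *)
Lemma moment_exponent_le : 2 * (k * (l + 9 + 4)) <= d.
Proof.
have := leq_trunc_div d (500 * l); have := mul_trunc_log_le; have := l_ge12.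
by rewrite /k; set q := d %/ _; nia.
Qed.

Lemma moment_constant_le : 48 ^ k * (2 * (k * d ^ 3) ^ k) <= 3 ^ (5 * d).
Proof.
have d4096 : 4096 <= d by [].
have kd : l.+1 * k <= d by have := moment_exponent_le; have := l_ge12; nia.
have kd' : k <= d by apply: leq_trans kd; rewrite leq_pmull.
apply: leq_trans (_ : (d ^ 5) ^ k <= _).
  apply: leq_trans (_ : (96 * (k * d ^ 3)) ^ k <= _).
    rewrite [leqRHS]expnMn mulnA leq_mul2r; apply/orP; right.
    rewrite -[96]/(48 * 2) expnMn leq_mul2l; apply/orP; right.
    exact: (@leq_pexp2l 2 1).
  rewrite leq_exp2r // [d ^ 5](expnD d 2 3) mulnA leq_mul2r; apply/orP; right.
  by rewrite -mulnn leq_mul // (leq_trans _ d4096).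
apply: leq_trans (_ : (2 ^ l.+1) ^ (5 * k) <= _).
  by rewrite -expnM leq_exp2r ?(ltnW lt_2l) // muln_gt0.
rewrite -expnM; apply: leq_trans (_ : 2 ^ (5 * d) <= _).
  by rewrite leq_exp2l // mulnCA leq_mul2l kd orbT.
by rewrite leq_exp2r // muln_gt0.
Qed.

Lemma small_tuple_constant_le : 12 * (9 ^ d) ^ 2 <= 3 ^ (5 * d).
Proof.
have -> : 5 * d = d + 4 * d by lia.
have -> : (9 ^ d) ^ 2 = 3 ^ (4 * d).
  by rewrite -[9]/(3 ^ 2) -!expnM; congr (_ ^ _); lia.
rewrite expnD leq_mul2r; apply/orP; right; apply: leq_trans (_ : 3 ^ 3 <= _) => //.
by rewrite leq_exp2l //; apply: leq_trans d_large.
Qed.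

Lemma leq_expn3_trunc_log : d <= 3 ^ (5 * l.+1).
Proof.
apply: leq_trans (ltnW lt_2l) _; apply: leq_trans (_ : 3 ^ l.+1 <= _).
  by rewrite leq_exp2r.
by rewrite leq_exp2l // leq_pmull.
Qed.

Context (N : nat).
Hypothesis N_gt0 : 0 < N.
Hypothesis le_N : N <= 3 ^ (d * d).

Lemma modulus_le_power : N <= X ^ k.
Proof.
apply: leq_trans le_N _; apply: leq_trans (_ : 2 ^ (2 * (d * d)) <= _).
  by rewrite [2 ^ _]expnM leq_exp2r ?muln_gt0 ?d_gt0.
apply: leq_trans (_ : (2 ^ l) ^ (1000 * d * k) <= _); last first.
  by rewrite /X -[(d ^ _) ^ k]expnM leq_exp2r ?muln_gt0 ?d_gt0.
rewrite -expnM leq_exp2l //.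
have : d <= 500 * l * k.
  by rewrite ltnW // mulnC ltn_ceil // muln_gt0 (leq_trans _ l_ge12).
nia.
Qed.

(** Chebyshev's bound at [X %/ 2] gives about [X / (2 log_2 X)] primes, where [log_2 X <= 1000 d^2],
    and at most [log_2 N <= 2 d^2] of them divide [N]. The resulting constant 4000 is absorbed by
    one more factor [d]. *)
Lemma primes_density (s : seq nat) :
  (forall p, prime p -> p <= X -> ~~ (p %| N) -> p \in s) -> X <= d ^ 3 * size s.
Proof.
move=> s_primes; have [c cE] : exists c, c = 1000 by exists 1000.
have c4 : 4 * c <= d by rewrite cE; apply: leq_trans d_large.
have d16 : 16 <= d by apply: leq_trans d_large.
have X6 : d ^ 6 <= X.
  rewrite /X leq_exp2l ?(leq_trans _ d16) // -[6]/(1 * 6).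
  by rewrite leq_mul // (leq_trans _ d16).
have X_ge : 16 * c * d ^ 4 <= X.
  apply: leq_trans X6; rewrite [d ^ 6](expnD d 2 4) leq_mul2r; apply/orP; right.
  by rewrite -mulnn leq_mul // (leq_trans _ c4) // leq_pmull.
pose h := X %/ 2; have hX : h + h <= X by have := leq_trunc_div X 2; rewrite /h; lia.
have Xh : X <= h + h + 1 by have := divn_eq X 2; have := ltn_mod X 2; rewrite /h; lia.
have h_gt0 : 0 < h by have := expn_gt0 d 4; rewrite d_gt0 /=; lia.
have /(central_bin_le h_gt0) : forall p, prime p -> p <= h + h -> p \in s ++ primes N.
  move=> p pr_p le_p; rewrite mem_cat mem_primes pr_p N_gt0 /=.
  by case: (boolP (p %| N)) => [|ndv]; rewrite ?orbT // s_primes // (leq_trans le_p).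
rewrite size_cat => le_h.
have w_le : size (primes N) <= 2 * (d * d).
  rewrite -(@leq_exp2l 2) //; apply: leq_trans (expn2_size_primes N_gt0) _.
  by apply: leq_trans le_N _; rewrite [2 ^ _]expnM leq_exp2r ?muln_gt0 ?d_gt0.
have l1d : l.+1 <= d by have := mul_trunc_log_le; have := l_ge12; lia.
have {le_h} : h <= d * (c * d) * (size s + 2 * (d * d)).
  rewrite -(@leq_exp2l 2) // cE; apply: leq_trans le_h _.
  apply: leq_trans (_ : X ^ (size s + 2 * (d * d)) <= _).
    apply: leq_trans (_ : X ^ (size s + size (primes N)) <= _).
      have [->|w0] := posnP (size s + size (primes N)); first by [].
      by rewrite leq_exp2r.
    by rewrite leq_pexp2l ?leq_add2l // /X expn_gt0 d_gt0.
  rewrite /X -expnM; set t := 1000 * d * _.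
  apply: leq_trans (_ : (2 ^ l.+1) ^ t <= _).
    by rewrite leq_exp2r ?(ltnW lt_2l) //; nia.
  by rewrite -expnM leq_exp2l // -[leqRHS]mulnA leq_mul2r l1d orbT.
have d4 : d ^ 4 = d * d * (d * d) by rewrite !expnS expn0; lia.
have d3 : d ^ 3 = d * (d * d) by rewrite !expnS expn0; lia.
move: X_ge; rewrite d4 d3; set a := d * d => X_ge le_h.
have a1 : 0 < a by rewrite muln_gt0 d_gt0.
have h1 : h <= c * a * size s + 2 * (c * (a * a)).
  by apply: leq_trans le_h _; rewrite /a; nia.
have h2 : X <= 4 * c * (a * size s) by nia.
by apply: leq_trans h2 _; rewrite -[leqRHS]mulnA leq_mul2r c4 orbT.
Qed.

End NumericalBounds.

Import Order.TTheory GRing.Theory Num.Theory.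

Local Open Scope ring_scope.

(** * Characters and moments of character sums *)

(** The dual group as an abstract finite group paired with [gT]. [pairing_sum] is orthogonality in
    the character variable; [card_pairing] follows from it. *)
Record dual_pairing (lT gT : finGroupType) (c : lT -> gT -> algC) : Prop := {
  pairing_comm : forall x y : lT, (x * y = y * x)%g;
  pairingMl : forall x y g, c (x * y)%g g = c x g * c y g;
  pairingMr : forall x g h, c x (g * h)%g = c x g * c x h;
  pairing_norm : forall x g, `|c x g| = 1;
  pairing_sum : forall g, \sum_x c x g = (#|gT| * (g == 1%g))%:R }.

Lemma dual_pairing_exists (gT : finGroupType) : abelian [set: gT] ->
  exists (lT : finGroupType) (c : lT -> gT -> algC), dual_pairing c.
Proof.
move=> abG; have [lT [cF [cF_inj cardL linF surjF] [cF1 cFM _ _ _]]] :=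
  lin_char_group [set: gT]%G.
have cE x y g : cF (x * y)%g g = cF x g * cF y g by rewrite cFM cfunE.
exists lT, (fun x g => cF x g); split=> //.
- by move=> x y; apply: cF_inj; rewrite !cFM mulrC.
- by move=> x g h; rewrite lin_charM ?inE.
- by move=> x g; rewrite normC_lin_char ?inE.
move=> g; have [-> | g1] := eqVneq g 1%g.
  rewrite (eq_bigr (fun _ => 1)); last by move=> x _; rewrite lin_char1.
  rewrite sumr_const muln1; congr (_%:R).
  by rewrite cardL (derG1P abG) indexg1 cardsT.
rewrite muln0; have [x0 x0g] : exists x0, cF x0 g != 1.
  have: g \notin (\bigcap_i cfker 'chi[[set: gT]%G]_i)%g.
    by rewrite TI_cfker_irr inE.
  move/bigcapP=> kerg; have [i] : exists i, g \notin cfker 'chi[[set: gT]%G]_i.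
    apply/existsP; apply: contraT; rewrite negb_exists => /forallP keri.
    by case: kerg => i _; move: (keri i); rewrite negbK.
  have lini : 'chi[[set: gT]%G]_i \is a linear_char.
    by apply/char_abelianP.
  have [x0 ->] := surjF _ lini; rewrite cfkerEchar ?lin_charW // !inE /=.
  by rewrite lin_char1 // => ?; exists x0.
(* Translation by [x0] permutes the characters, so the sum is fixed by a factor different from 1 and
   must vanish. *)
apply/eqP; have: cF x0 g * (\sum_x cF x g) = \sum_x cF x g.
  rewrite mulr_sumr [RHS](reindex_inj (mulgI x0)) /=.
  by apply: eq_bigr => x _; rewrite cE.
move/eqP; rewrite -subr_eq0 -[X in _ - X]mul1r -mulrBl mulf_eq0.
by rewrite subr_eq0 (negPf x0g).
Qed.

Section Pairing.

Context (lT gT : finGroupType) (c : lT -> gT -> algC) (hc : dual_pairing c).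

Lemma pairing_neq0 x g : c x g != 0.
Proof. by rewrite -normr_eq0 (pairing_norm hc) oner_eq0. Qed.

Lemma pairing1l g : c 1%g g = 1.
Proof.
apply: (mulIf (pairing_neq0 1%g g)).
by rewrite -(pairingMl hc) mulg1 mul1r.
Qed.

Lemma pairing1r x : c x 1%g = 1.
Proof.
apply: (mulIf (pairing_neq0 x 1%g)).
by rewrite -(pairingMr hc) mulg1 mul1r.
Qed.

Lemma pairingXl x g n : c (x ^+ n)%g g = c x g ^+ n.
Proof.
elim: n => [|n IHn]; first by rewrite expg0 pairing1l.
by rewrite expgS (pairingMl hc) IHn exprS.
Qed.

Lemma pairingXr x g n : c x (g ^+ n)%g = c x g ^+ n.
Proof.
elim: n => [|n IHn]; first by rewrite expg0 pairing1r.
by rewrite expgS (pairingMr hc) IHn exprS.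
Qed.

Lemma pairing_prod (J : Type) (s : seq J) (P : pred J) (F : J -> gT) x :
  c x (\prod_(j <- s | P j) F j)%g = \prod_(j <- s | P j) c x (F j).
Proof. exact: (big_morph _ (pairingMr hc x) (pairing1r x)). Qed.

Lemma pairing_conj x g : (c x g)^* = c x g^-1%g.
Proof.
apply: (mulfI (pairing_neq0 x g)).
by rewrite -normCK (pairing_norm hc) expr1n -(pairingMr hc) mulgV pairing1r.
Qed.

Definition charsum (I : finType) (u : I -> gT) (x : lT) : algC :=
  \sum_i c x (u i).

Context (I : finType) (u : I -> gT).

Lemma charsum_norm_le x : `|charsum u x| <= #|I|%:R.
Proof.
apply: le_trans (ler_norm_sum _ _ _) _.
under eq_bigr => i _ do rewrite (pairing_norm hc).
by rewrite sumr_const.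
Qed.

Lemma charsumX x k :
  charsum u x ^+ k =
  \sum_(p : {ffun 'I_k -> I}) c x (\prod_(t < k) u (p t))%g.
Proof.
rewrite -{1}[k]card_ord -prodr_const bigA_distr_bigA /=.
by apply: eq_bigr => p _; rewrite pairing_prod.
Qed.

(** Orthogonality turns the moment into [#|gT|] times the number of pairs of [k]-tuples with equal
    product, and each tuple has at most [A] partners. *)
Lemma charsum_moment k A :
  (forall h, #|[set p : {ffun 'I_k -> I} |
                 (\prod_(t < k) u (p t))%g == h]| <= A)%N ->
  \sum_x `|charsum u x| ^+ (2 * k) <= (#|gT| * A * #|I| ^ k)%:R.
Proof.
move=> leA; pose w (p : {ffun 'I_k -> I}) := (\prod_(t < k) u (p t))%g.
have -> : \sum_x `|charsum u x| ^+ (2 * k) =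
    (\sum_p \sum_q #|gT| * (w p == w q))%N%:R.
  transitivity (\sum_x \sum_p \sum_q c x (w p * (w q)^-1)%g).
    apply: eq_bigr => x _; rewrite mulnC exprM -normrX normCK charsumX rmorph_sum.
    rewrite mulr_suml; apply: eq_bigr => p _; rewrite mulr_sumr.
    by apply: eq_bigr => q _; rewrite /= pairing_conj -(pairingMr hc).
  rewrite exchange_big natr_sum; apply: eq_bigr => p _.
  rewrite exchange_big natr_sum; apply: eq_bigr => q _.
  by rewrite (pairing_sum hc) -eq_mulgV1.
rewrite ler_nat -mulnA; under eq_bigr => p _ do rewrite -big_distrr /=.
rewrite -big_distrr /= leq_mul2l; apply/orP; right.
have -> : (A * #|I| ^ k = \sum_(p : {ffun 'I_k -> I}) A)%N.
  by rewrite sum_nat_const card_ffun card_ord mulnC.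
apply: leq_sum => p _.
apply: leq_trans (leA (w p)); rewrite -sum1dep_card [leqRHS]big_mkcond /=.
by apply: eq_leq; apply: eq_bigr => q _; rewrite /w eq_sym; case: eqP.
Qed.

End Pairing.

Lemma norm_expB1_le (R : numDomainType) (z : R) (n : nat) :
  `|z| = 1 -> `|z ^+ n - 1| <= n%:R * `|z - 1|.
Proof.
move=> z1; rewrite subrX1 normrM mulrC ler_wpM2r ?normr_ge0 //.
apply: le_trans (ler_norm_sum _ _ _) _.
under eq_bigr => i _ do rewrite normrX z1 expr1n.
by rewrite sumr_const card_ord.
Qed.

Lemma ler_sum_inj (R : numDomainType) (J L : finType) (m : J -> L) (F : L -> R) :
  injective m -> (forall l, 0 <= F l) -> \sum_j F (m j) <= \sum_l F l.
Proof.
move=> m_inj F0; rewrite [leRHS](bigID (mem [set m j | j in J])) /=.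
rewrite big_imset /=; last by move=> ? ? _ _; apply: m_inj.
by rewrite lerDl; apply: sumr_ge0.
Qed.

(** Each term is within [K * (2 * e) <= 1 / 2] of 1. The tolerance is doubled because [z] will be a
    quotient of two values, each within [e] of 1. *)
Lemma sum_exp_near1 (z e : algC) (K : nat) :
  `|z| = 1 -> `|z - 1| <= 2 * e -> 4 * K%:R * e <= 1 ->
  K%:R / 2 <= `|\sum_(a < K) z ^+ a|.
Proof.
move=> z1 ze Ke.
have e0 : 0 <= 2 * e by apply: le_trans ze; apply: normr_ge0.
have sumB : `|\sum_(a < K) z ^+ a - K%:R| <= K%:R / 2.
  have -> : \sum_(a < K) z ^+ a - K%:R = \sum_(a < K) (z ^+ a - 1).
    by rewrite big_split /= sumr_const card_ord mulNrn.
  apply: le_trans (ler_norm_sum _ _ _) _.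
  apply: (@le_trans _ _ (\sum_(a < K) (1 / 2 : algC))); last first.
    by rewrite sumr_const card_ord -[_ *+ _]mulr_natl mul1r.
  apply: ler_sum => a _; apply: le_trans (norm_expB1_le _ z1) _.
  apply: (@le_trans _ _ (K%:R * (2 * e))).
    by rewrite ler_pM // ?ler_nat ?(ltnW (ltn_ord a)).
  rewrite ler_pdivlMr //; apply: le_trans Ke.
  by rewrite le_eqVlt; apply/orP; left; apply/eqP; ring.
have := lerB_dist K%:R (\sum_(a < K) z ^+ a).
rewrite distrC => h; have {h} := le_trans h sumB.
rewrite normr_nat lerBlDl -lerBlDr; apply: le_trans.
rewrite le_eqVlt; apply/orP; left; apply/eqP.
by field.
Qed.

(* Induction on [k], each step being Chebyshev's sum inequality. *)
Lemma power_mean (R : numDomainType) (J : finType) (P : pred J) (a : J -> R) k :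
  (forall j, 0 <= a j) ->
  (\sum_(j | P j) a j) ^+ k.+1 <= #|P|%:R ^+ k * \sum_(j | P j) a j ^+ k.+1.
Proof.
move=> a0; elim: k => [|k IHk]; first by rewrite expr0 mul1r expr1.
have S0 : 0 <= \sum_(j | P j) a j by apply: sumr_ge0.
rewrite exprS; apply: le_trans (ler_wpM2l S0 IHk) _.
rewrite mulrCA exprSr -mulrA ler_wpM2l ?exprn_ge0 ?ler0n //.
rewrite -subr_ge0 -(pmulrn_lge0 _ (isT : 0 < 2)%N).
have -> : (#|P|%:R * (\sum_(j | P j) a j ^+ k.+2) -
    (\sum_(j | P j) a j) * (\sum_(j | P j) a j ^+ k.+1)) *+ 2 =
    \sum_(i | P i) \sum_(j | P j) (a i - a j) * (a i ^+ k.+1 - a j ^+ k.+1).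
  pose s1 := \sum_(j | P j) a j; pose sk := \sum_(j | P j) a j ^+ k.+1.
  pose sk2 := \sum_(j | P j) a j ^+ k.+2.
  transitivity (\sum_(i | P i)
    (#|P|%:R * a i ^+ k.+2 - a i * sk - s1 * a i ^+ k.+1 + sk2)).
    rewrite big_split /= !sumrB -mulr_sumr -mulr_suml -mulr_sumr sumr_const.
    by rewrite -/s1 -/sk -/sk2 -[sk2 *+ _]mulr_natl; ring.
  apply: eq_bigr => i _.
  under eq_bigr => j _ do rewrite mulrBl !mulrBr opprB addrA -!exprS addrAC.
  rewrite !big_split /= !sumrN sumr_const -mulr_sumr -mulr_suml.
  by rewrite -/s1 -/sk -/sk2 -mulr_natl; ring.
apply: sumr_ge0 => i _; apply: sumr_ge0 => j _.
case/orP: (real_leVge (ger0_real (a0 i)) (ger0_real (a0 j))) => le_a.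
  by rewrite mulr_le0 // subr_le0 // lerXn2r ?nnegrE.
by rewrite mulr_ge0 // subr_ge0 // lerXn2r ?nnegrE.
Qed.

(** * Energy of the powers of a character *)

Section PowerEnergy.

Context (lT gT : finGroupType) (c : lT -> gT -> algC) (hc : dual_pairing c).
Context (I : finType) (u : I -> gT).

Definition power_energy (K : nat) (x : lT) : algC :=
  \sum_(j < K) `|charsum c u (x ^+ j.+1)%g| ^+ 2.

Definition near_one (e : algC) (x : lT) : {set I} :=
  [set i | `|c x (u i) - 1| <= e].

Lemma power_energy_ge0 K x : 0 <= power_energy K x.
Proof. by apply: sumr_ge0 => j _; rewrite exprn_ge0. Qed.

Lemma power_energy_le K x : power_energy K x <= K%:R * #|I|%:R ^+ 2.
Proof.
rewrite /power_energy mulr_natl -[X in _ *+ X]card_ord -sumr_const.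
apply: ler_sum => j _.
by rewrite lerXn2r ?nnegrE ?ler0n // charsum_norm_le.
Qed.

(** The truncated subtractions encode the distance [|a - b|]. It is 0 once, which gives the trivial
    term, and takes every other value at most twice. *)
Lemma power_energy_distn K x (a : nat) : (a < K)%N ->
  \sum_(0 <= b < K) `|charsum c u (x ^+ ((a - b) + (b - a)))%g| ^+ 2 <=
  #|I|%:R ^+ 2 + 2 * power_energy K x.
Proof.
move=> lt_aK; pose F j := `|charsum c u (x ^+ j)%g| ^+ 2.
have F0 j : 0 <= F j by rewrite exprn_ge0.
have FT n : (n <= K)%N -> \sum_(0 <= j < n) F j.+1 <= power_energy K x.
  move=> le_nK; rewrite /power_energy -(big_mkord xpredT (fun j => F j.+1)).
  rewrite (big_cat_nat (leq0n n) le_nK) /= lerDl.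
  by apply: sumr_ge0 => j _; apply: F0.
rewrite (big_cat_nat (leq0n a) (ltnW lt_aK)) /=.
have -> : \sum_(0 <= b < a) F (a - b + (b - a))%N = \sum_(0 <= b < a) F b.+1.
  rewrite big_nat_rev /= add0n; apply: eq_big_nat => b /andP[_ lt_ba].
  by congr F; lia.
have -> : \sum_(a <= b < K) F (a - b + (b - a))%N =
    F 0%N + \sum_(0 <= b < (K - a).-1) F b.+1.
  rewrite big_ltn // subnn addn0 big_add1 -{1}[a]add0n big_addn; congr (_ + _).
  rewrite -subn1 subnAC subn1; apply: eq_big_nat => b _; congr F; lia.
have leF0 : F 0%N <= #|I|%:R ^+ 2.
  by rewrite lerXn2r ?nnegrE ?ler0n // charsum_norm_le.
rewrite mulr2n mulrDl !mul1r addrCA lerD // lerD // FT //; first exact: ltnW.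
by apply: leq_trans (leq_pred _) _; apply: leq_subr.
Qed.

Lemma near_one_energy e K x : 4 * K%:R * e <= 1 ->
  K%:R * #|near_one e x|%:R ^+ 2 <= 4 * (#|I|%:R ^+ 2 + 2 * power_energy K x).
Proof.
move=> Ke; case: K Ke => [|K] Ke.
  by rewrite mul0r mulr_ge0 // addr_ge0 ?exprn_ge0 ?mulr_ge0 ?power_energy_ge0.
set N := K.+1 in Ke *.
pose z i := c x (u i); have z1 i : `|z i| = 1 by apply: pairing_norm hc _ _.
have zC i : z i * (z i)^* = 1 by rewrite -normCK z1 expr1n.
pose D w := \sum_(a < N) w ^+ a : algC.
have upper : \sum_(a < N) \sum_(b < N) `|\sum_i z i ^+ a * (z i)^* ^+ b| ^+ 2
    <= N%:R * (#|I|%:R ^+ 2 + 2 * power_energy N x).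
  rewrite mulr_natl -[X in _ *+ X]card_ord -sumr_const; apply: ler_sum => a _.
  apply: le_trans (power_energy_distn x (ltn_ord a)); rewrite big_mkord.
  rewrite le_eqVlt; apply/orP; left; apply/eqP; apply: eq_bigr => b _.
  congr (_ ^+ 2); have [le_ab|/ltnW le_ba] := leqP a b.
    have -> : (a - b + (b - a) = b - a)%N by lia.
    rewrite -norm_conjC rmorph_sum /charsum; congr `|_|; apply: eq_bigr => i _.
    rewrite (pairingXl hc) -/(z i) rmorphM !rmorphXn /= conjCK.
    by rewrite -{1}(subnK le_ab) exprD mulrCA -exprMn [_^* * _]mulrC zC
      expr1n mulr1.
  have -> : (a - b + (b - a) = a - b)%N by lia.
  congr `|_|; apply: eq_bigr => i _; rewrite (pairingXl hc) -/(z i).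
  by rewrite -{1}(subnK le_ba) exprD -mulrA -exprMn zC expr1n mulr1.
have lower : (N%:R / 2) ^+ 2 * #|near_one e x|%:R ^+ 2 <=
    \sum_(a < N) \sum_(b < N) `|\sum_i z i ^+ a * (z i)^* ^+ b| ^+ 2.
  have -> : \sum_(a < N) \sum_(b < N) `|\sum_i z i ^+ a * (z i)^* ^+ b| ^+ 2 =
      \sum_i \sum_j `|D (z i * (z j)^*)| ^+ 2.
    transitivity (\sum_(a < N) \sum_(b < N) \sum_i \sum_j
        (z i * (z j)^*) ^+ a * ((z i * (z j)^*)^*) ^+ b).
      apply: eq_bigr => a _; apply: eq_bigr => b _; rewrite normCK rmorph_sum.
      rewrite mulr_suml; apply: eq_bigr => i _; rewrite mulr_sumr.
      apply: eq_bigr => j _.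
      by rewrite !(rmorphM, rmorphXn) /= conjCK !exprMn; ring.
    under eq_bigr => a _ do rewrite exchange_big.
    rewrite exchange_big; apply: eq_bigr => i _.
    under eq_bigr => a _ do rewrite exchange_big.
    rewrite exchange_big; apply: eq_bigr => j _.
    rewrite normCK rmorph_sum mulr_suml; apply: eq_bigr => a _.
    by rewrite mulr_sumr; apply: eq_bigr => b _; rewrite rmorphXn.
  pose A := near_one e x.
  have -> : (N%:R / 2) ^+ 2 * #|A|%:R ^+ 2 =
      \sum_(i in A) \sum_(j in A) (N%:R / 2) ^+ 2 :> algC.
    by rewrite !sumr_const -mulrnA -[RHS]mulr_natr natrM -expr2.
  have D0 i j : 0 <= `|D (z i * (z j)^*)| ^+ 2 by rewrite exprn_ge0.
  rewrite big_mkcond; apply: ler_sum => i _; case: ifPn => [Ai|_]; last first.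
    exact: sumr_ge0.
  rewrite big_mkcond; apply: ler_sum => j _; case: ifPn => [Aj|_] //.
  rewrite lerXn2r ?nnegrE ?divr_ge0 ?ler0n //; apply: (@sum_exp_near1 _ e) => //.
    by rewrite normrM norm_conjC !z1 mulr1.
  have -> : z i * (z j)^* - 1 = (z i - 1) * (z j)^* + (z j - 1)^*.
    by rewrite rmorphB rmorph1 mulrBl mul1r; ring.
  apply: le_trans (ler_normD _ _) _.
  rewrite normrM !norm_conjC z1 mulr1 mulr_natl mulr2n.
  by move: Ai Aj; rewrite !inE => Ai Aj; apply: lerD.
have N0 : 0 < N%:R :> algC by rewrite ltr0n.
rewrite -(ler_pM2l N0); have := le_trans lower upper.
have -> : (N%:R / 2) ^+ 2 * #|near_one e x|%:R ^+ 2 =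
    N%:R * (N%:R * #|near_one e x|%:R ^+ 2) / 4 :> algC by field.
by rewrite ler_pdivrMr // -mulrA [_ * 4]mulrC.
Qed.

Lemma energy_multiples K x h : (0 < h)%N ->
  \sum_(j < K | (h %| j.+1)%N) `|charsum c u (x ^+ j.+1)%g| ^+ 2 =
  power_energy (K %/ h) (x ^+ h)%g.
Proof.
move=> h0; rewrite /power_energy; elim: K => [|K IHK].
  by rewrite div0n !big_ord0.
rewrite big_mkcond big_ord_recr -big_mkcond /= IHK divnS //.
case: ifPn => hK; last by rewrite addr0 add0n.
rewrite add1n big_ord_recr /=; congr (_ + _).
rewrite -expgM mulnS.
have -> : (h + h * (K %/ h) = K.+1)%N; last by [].
by rewrite -mulnS -add1n -[(1 + _)%N]/(true + _)%N -hK -divnS // mulnC divnK.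
Qed.

(* At most the fraction [h^(-1/2)] of the energy sits on exponents divisible by [h]. *)
Definition energy_maximal (K : nat) (x : lT) : bool :=
  [forall h : 'I_K.+1, (1 < h)%N ==>
    (h%:R * power_energy (K %/ h) (x ^+ h)%g ^+ 2 <= power_energy K x ^+ 2)].

(** A dilation [h] violating maximality leads to the smaller instance [(K %/ h, x ^+ h)], and the
    gains [h] multiply up to [g]. *)
Lemma energy_maximal_exists K x : exists2 g, (0 < g)%N &
  energy_maximal (K %/ g) (x ^+ g)%g /\
  power_energy K x ^+ 2 <= g%:R * power_energy (K %/ g) (x ^+ g)%g ^+ 2.
Proof.
elim/ltn_ind: K x => K IHK x.
case: (boolP (energy_maximal K x)) => [maxK|].
  by exists 1%N => //; rewrite divn1 expg1 mul1r.
rewrite negb_forall => /existsP[h]; rewrite negb_imply => /andP[h1].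
rewrite -real_ltNge ?ger0_real ?mulr_ge0 ?exprn_ge0 ?ler0n ?power_energy_ge0 //.
move=> lt_h; have K0 : (0 < K)%N by rewrite (leq_trans (ltnW h1)) // -ltnS.
have [g g0 [maxg le_g]] := IHK _ (ltn_Pdiv h1 K0) (x ^+ h)%g.
exists (h * g)%N; first by rewrite muln_gt0 g0 (ltnW h1).
rewrite divnMA expgM; split=> //.
apply: le_trans (ltW lt_h) _.
by rewrite natrM -mulrA ler_wpM2l ?ler0n.
Qed.

(** Telescoping from the exact value 1/4 at [n = 2]. The bound 3/4 leaves a quarter of the energy to
    coprime quadruples. *)
Lemma sum_inv_sqr_le n : (1 < n)%N ->
  \sum_(2 <= h < n.+1) (h%:R : algC)^-1 ^+ 2 <= 3 / 4 - n%:R^-1.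
Proof.
elim: n => [//|n IHn]; rewrite ltnS leq_eqVlt => /orP[/eqP<-|n1].
  rewrite big_nat1 -subr_ge0.
  by have -> : (3 / 4 - 2^-1 - 2^-1 ^+ 2 = 0 :> algC) by field.
rewrite big_nat_recr /=; last by rewrite ltnW.
apply: le_trans (lerD (IHn n1) (lexx _)) _.
rewrite -subr_ge0.
have n0 : n%:R != 0 :> algC by rewrite pnatr_eq0 -lt0n ltnW.
have -> : 3 / 4 - n.+1%:R^-1 - (3 / 4 - n%:R^-1 + n.+1%:R^-1 ^+ 2) =
   (n%:R * n.+1%:R ^+ 2)^-1 :> algC.
  have n1' : n%:R + 1 != 0 :> algC by rewrite natr1 pnatr_eq0.
  by rewrite -natr1; field; rewrite [1 + _]addrC n1'.
by rewrite invr_ge0 mulr_ge0 ?exprn_ge0.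
Qed.

Let tgcd K (f : {ffun 'I_4 -> 'I_K}) := (\big[gcdn/0]_t (f t).+1)%N.

(** Quadruples of exponents all divisible by [h] carry the fourth power of a dilated energy, which
    maximality bounds by [h^-2 T^4]; over [h >= 2] this totals at most 3/4 of [T^4]. With triples
    the weights [h^(-3/2)] would sum to more than 1. *)
Lemma coprime_energy K x : energy_maximal K x ->
  power_energy K x ^+ 4 <= 4 * \sum_(f : {ffun 'I_4 -> 'I_K} | tgcd f == 1%N)
     \prod_t `|charsum c u (x ^+ (f t).+1)%g| ^+ 2.
Proof.
move=> /forallP maxK; set T := power_energy K x.
pose F (f : {ffun 'I_4 -> 'I_K}) := \prod_t `|charsum c u (x ^+ (f t).+1)%g| ^+ 2.
have F0 f : 0 <= F f by apply: prodr_ge0 => t _; rewrite exprn_ge0.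
have TE : T ^+ 4 = \sum_f F f.
  by rewrite -{1}[4%N]card_ord -prodr_const bigA_distr_bigA.
have divE (h : nat) : (0 < h)%N -> \sum_(f | (h %| tgcd f)%N) F f =
    power_energy (K %/ h) (x ^+ h)%g ^+ 4.
  move=> h0; rewrite -(energy_multiples K x h0).
  rewrite -[X in _ = _ ^+ X](card_ord 4) -prodr_const bigA_distr_big.
  apply: eq_bigl => f; apply/idP/ffun_onP => [hf t|hf].
    by apply: dvdn_trans hf _; rewrite /tgcd (bigD1 t) //= dvdn_gcdl.
  rewrite /tgcd; apply: (big_ind (fun m => h %| m)%N) => [|m n hm hn|t _].
  - exact: dvdn0.
  - by rewrite dvdn_gcd hm.
  - exact: hf.
have bad : \sum_(f | tgcd f != 1%N) F f <= 3 / 4 * T ^+ 4.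
  apply: (@le_trans _ _ (\sum_(2 <= h < K.+1) \sum_(f | (h %| tgcd f)%N) F f)).
    under [leRHS]eq_bigr => h _ do rewrite big_mkcond.
    rewrite exchange_big /= big_mkcond; apply: ler_sum => f _.
    case: ifPn => [f1|_]; last by apply: sumr_ge0 => h _; case: ifP.
    have le_gK : (tgcd f <= K)%N.
      rewrite /tgcd (bigD1 ord0) //=.
      by apply: leq_trans (dvdn_leq _ (dvdn_gcdl _ _)) (ltn_ord _).
    have g0 : (0 < tgcd f)%N by rewrite /tgcd (bigD1 ord0) //= gcdn_gt0.
    rewrite (bigD1_seq (tgcd f)) ?iota_uniq //=; last first.
      by rewrite mem_index_iota; move: f1 g0 le_gK; case: (tgcd f) => [|[]].
    by rewrite dvdnn lerDl; apply: sumr_ge0 => h _; case: ifP.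
  have T4 : 0 <= T ^+ 4 by rewrite exprn_ge0 // power_energy_ge0.
  apply: (@le_trans _ _ (\sum_(2 <= h < K.+1) h%:R^-1 ^+ 2 * T ^+ 4)).
    rewrite big_seq [leRHS]big_seq; apply: ler_sum => h.
    rewrite mem_index_iota => /andP[h1 hK]; rewrite divE ?(ltnW h1) //.
    have /implyP/(_ h1) /= := maxK (Ordinal hK); rewrite -/T => le_h.
    have h0 : 0 < h%:R ^+ 2 :> algC by rewrite exprn_gt0 // ltr0n ltnW.
    rewrite exprVn ler_pdivlMl // -[4%N]/(2 * 2)%N !exprM -exprMn.
    by rewrite lerXn2r ?nnegrE ?mulr_ge0 ?ler0n ?exprn_ge0 ?power_energy_ge0.
  rewrite -mulr_suml ler_wpM2r //.
  have [K1|K1] := ltnP 1 K.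
    by apply: le_trans (sum_inv_sqr_le K1) _; rewrite gerBl invr_ge0 ler0n.
  by rewrite big_geq // divr_ge0.
have {}TE : T ^+ 4 = \sum_(f | tgcd f == 1%N) F f + \sum_(f | tgcd f != 1%N) F f.
  by rewrite TE (bigID (fun f => tgcd f == 1%N)).
move: bad TE; set a := \sum_(f | _ == _) F f; set b := \sum_(f | _) F f.
move=> bad TE; rewrite TE in bad *.
rewrite -subr_ge0; rewrite -subr_ge0 in bad.
have -> : 4 * a - (a + b) = 4 * (3 / 4 * (a + b) - b) by field.
by rewrite mulr_ge0.
Qed.

(* A character is determined by four powers of it with coprime exponents. *)
Lemma sum_coprime_powers (F : lT -> algC) (e : 'I_4 -> nat) :
  (forall x, 0 <= F x) -> (\big[gcdn/0]_t e t = 1)%N ->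
  \sum_x \prod_t F (x ^+ e t)%g <= (\sum_x F x) ^+ 4.
Proof.
move=> F0 e1; rewrite -[X in _ ^+ X](card_ord 4) -prodr_const bigA_distr_bigA /=.
pose m x : {ffun 'I_4 -> lT} := [ffun t => x ^+ e t]%g.
have m_inj : injective m.
  move=> x y /ffunP mxy; apply/eqP; rewrite eq_mulgV1 -order_eq1 -dvdn1 -e1.
  apply: (big_ind (fun n => #[(x * y^-1)%g]%g %| n)%N) => [|a b ha hb|t _].
  - exact: dvdn0.
  - by rewrite dvdn_gcd ha.
  have := mxy t; rewrite !ffunE order_dvdn expgMn; last exact: (pairing_comm hc).
  by move=> ->; rewrite expgVn mulgV.
apply: le_trans (ler_sum_inj m_inj _).
  by apply: ler_sum => x _; apply: ler_prod => t _; rewrite F0 ffunE lexx.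
by move=> g; apply: prodr_ge0.
Qed.

Context (k : nat) (V : algC).
Hypothesis k_gt0 : (0 < k)%N.
Hypothesis momentV : \sum_x `|charsum c u x| ^+ (2 * k) <= V.

(** The [k]-th power of [coprime_energy], expanded by the power mean over at most [K ^ 4]
    quadruples; each quadruple then costs at most [V ^ 4] by [sum_coprime_powers] applied to
    [|S|^(2k)]. *)
Lemma coprime_moment K :
  \sum_(x | energy_maximal K x) power_energy K x ^+ (4 * k) <=
  4 ^+ k * K%:R ^+ (4 * k) * V ^+ 4.
Proof.
pose F x (f : {ffun 'I_4 -> 'I_K}) := \prod_t `|charsum c u (x ^+ (f t).+1)%g| ^+ 2.
have F0 x f : 0 <= F x f by apply: prodr_ge0 => t _; rewrite exprn_ge0.
pose P (f : {ffun 'I_4 -> 'I_K}) := tgcd f == 1%N.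
have cardP : (#|P| <= K ^ 4)%N.
  by apply: leq_trans (max_card _) _; rewrite card_ffun !card_ord.
have V0 : 0 <= V.
  by apply: le_trans momentV; apply: sumr_ge0 => x _; rewrite exprn_ge0.
apply: (@le_trans _ _ (\sum_x 4 ^+ k * ((K ^ 4) ^ k.-1)%N%:R *
    (\sum_(f | P f) F x f ^+ k))).
  rewrite big_mkcond; apply: ler_sum => x _; case: ifPn => [maxx|_]; last first.
    rewrite mulr_ge0 ?mulr_ge0 ?exprn_ge0 ?ler0n //.
    by apply: sumr_ge0 => f _; rewrite exprn_ge0.
  rewrite exprM; have := coprime_energy maxx => /(lerXn2r k).
  rewrite !nnegrE => /(_ (exprn_ge0 _ (power_energy_ge0 _ _))).
  move=> /(_ (mulr_ge0 (ler0n _ _) (sumr_ge0 _ (fun f _ => F0 x f)))).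
  move=> h; apply: le_trans h _; rewrite exprMn -mulrA ler_wpM2l ?exprn_ge0 //.
  rewrite -[k in leLHS](prednK k_gt0); apply: le_trans (power_mean _ _ (F0 x)) _.
  rewrite (prednK k_gt0) ler_wpM2r //.
    by apply: sumr_ge0 => f _; rewrite exprn_ge0.
  by rewrite -natrX ler_nat; by case: (k.-1) => // k'; rewrite leq_exp2r.
rewrite -mulr_sumr exchange_big /=.
apply: (@le_trans _ _ (4 ^+ k * ((K ^ 4) ^ k.-1)%:R * \sum_(f | P f) V ^+ 4)).
  rewrite ler_wpM2l ?mulr_ge0 ?exprn_ge0 //; apply: ler_sum => f /eqP Pf.
  have := sum_coprime_powers (F := fun x => `|charsum c u x| ^+ (2 * k))
    (fun x => exprn_ge0 _ (normr_ge0 _)) Pf.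
  move=> h; apply: (le_trans _ (le_trans h _)); last first.
    rewrite lerXn2r ?nnegrE //.
    by apply: sumr_ge0 => x _; rewrite exprn_ge0.
  apply: ler_sum => x _; rewrite le_eqVlt; apply/orP; left; apply/eqP.
  by rewrite -prodrXl; apply: eq_bigr => t _; rewrite exprM.
rewrite sumr_const -[V ^+ 4 *+ _]mulr_natl mulrA ler_wpM2r ?exprn_ge0 //.
rewrite -mulrA ler_wpM2l ?exprn_ge0 // -natrM -natrX ler_nat.
apply: leq_trans (leq_mul (leqnn _) cardP) _.
by rewrite -expnSr (prednK k_gt0) -expnM.
Qed.

(** After the power mean, distinct powers are distinct characters, so their contributions form part
    of the full moment. *)
Lemma distinct_powers_energy K x :
  injective (fun j : 'I_K => x ^+ j.+1)%g ->
  power_energy K x ^+ k <= K%:R ^+ k.-1 * V.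
Proof.
move=> x_inj; rewrite -[k in leLHS](prednK k_gt0).
apply: le_trans (power_mean _ _ _) _ => [j|]; first by rewrite exprn_ge0.
rewrite (prednK k_gt0) cardT size_enum_ord ler_wpM2l ?exprn_ge0 ?ler0n //.
apply: le_trans momentV; under eq_bigr => j _ do rewrite -exprM.
apply: (ler_sum_inj (F := fun x => `|charsum c u x| ^+ (2 * k)) x_inj) => y.
by rewrite exprn_ge0.
Qed.

End PowerEnergy.

(** * Tuples on which a character of large order is close to 1 *)

Section BadTuples.

Context (lT gT : finGroupType) (c : lT -> gT -> algC) (hc : dual_pairing c).
Context (I : finType) (u : I -> gT).

Lemma card_pairing : #|lT| = #|gT|.
Proof.
have := pairing_sum hc 1%g; rewrite eqxx muln1.
under eq_bigr => x _ do rewrite (pairing1r hc).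
by rewrite sumr_const => /eqP; rewrite eqr_nat => /eqP.
Qed.

(** The largest error that [sum_exp_near1] admits for [K > 0]; it is 0 at [K = 0]. *)
Definition tolerance (K : nat) : algC := (4 * K%:R)^-1.

Definition near_tuples (d K : nat) (x : lT) : {set {ffun 'I_d -> I}} :=
  [set f : {ffun 'I_d -> I} | [forall i, f i \in near_one c u (tolerance K) x]].

Definition bad_tuples (d K : nat) : {set {ffun 'I_d -> I}} :=
  \bigcup_(x | (K < #[x]%g)%N) near_tuples d K x.

Lemma card_near_tuples d K x :
  #|near_tuples d K x| = (#|near_one c u (tolerance K) x| ^ d)%N.
Proof.
rewrite -[d in RHS]card_ord -card_ffun_on; apply: eq_card => f.
by rewrite inE; apply/forallP/ffun_onP.
Qed.

Lemma tolerance_le K : 4 * K%:R * tolerance K <= 1.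
Proof.
rewrite /tolerance; have [->|K0] := eqVneq K 0%N.
  by rewrite mulr0 mul0r.
by rewrite divff // mulf_neq0 // pnatr_eq0.
Qed.

(** Raising to the power [g] multiplies the distance to 1 by at most [g], while the tolerance grows
    by a factor of at least [g]. *)
Lemma near_tuples_exp d K g x : (0 < K %/ g)%N ->
  near_tuples d K x \subset near_tuples d (K %/ g) (x ^+ g)%g.
Proof.
move=> K'0; have Kg : (g * (K %/ g) <= K)%N by rewrite mulnC leq_trunc_div.
have K0 : (0 < K)%N by apply: leq_trans K'0 (leq_div _ _).
apply/subsetP => f; rewrite !inE => /forallP xf; apply/forallP => i.
move: (xf i); rewrite !inE (pairingXl hc) => xfi.
apply: le_trans (norm_expB1_le _ (pairing_norm hc _ _)) _.
apply: le_trans (ler_wpM2l (ler0n _ _) xfi) _.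
rewrite /tolerance ler_pdivrMr ?mulr_gt0 ?ltr0n // mulrC.
rewrite ler_pdivlMr ?mulr_gt0 ?ltr0n //.
by rewrite mulrCA ler_wpM2l // -natrM ler_nat.
Qed.

(** * Counting bad tuples according to energy *)

Section Count.

Context (d k m q Q v A : nat).
Hypothesis k_gt0 : (0 < k)%N.
Hypothesis I_gt0 : (0 < #|I|)%N.
Hypothesis leA : forall h, (#|[set p : {ffun 'I_k -> I} |
                 (\prod_(t < k) u (p t))%g == h]| <= A)%N.
Hypothesis le_v : (#|gT| * A <= v * #|I| ^ k)%N.
Hypothesis le_d : (2 * (k * (m + 4)) <= d)%N.
Hypothesis le_q : (12 * q ^ 2 <= Q)%N.
Hypothesis le_Q : (48 ^ k * v <= Q)%N.
Hypothesis q_gt0 : (0 < q)%N.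

Let V : algC := (v * #|I| ^ (2 * k))%:R.
Let T := power_energy c u.
Let pi : algC := #|I|%:R.

Let Q_gt0 : (0 < Q)%N.
Proof. by apply: leq_trans le_q; rewrite muln_gt0 expn_gt0 q_gt0. Qed.

Let momentV : \sum_x `|charsum c u x| ^+ (2 * k) <= V.
Proof.
apply: le_trans (charsum_moment hc leA) _; rewrite ler_nat.
apply: leq_trans (leq_mul le_v (leqnn _)) _.
by rewrite -mulnA -expnD addnn mul2n.
Qed.

(** What is kept of a bad character of large energy after passing to a maximal dilation: the energy
    dominates the diagonal term and obeys the bound for distinct powers. *)
Let large (K : nat) (x : lT) :=
  [&& energy_maximal c u K x, pi ^+ 2 <= T K x & T K x ^+ k <= K%:R ^+ k.-1 * V].

(** Here [near_one_energy] gives [Q r^2 <= 12 #|I|^2] for the number [r] of near indices, and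
    [12 q^2 <= Q] turns this into [q r <= #|I|]. *)
Lemma card_near_tuples_small x : T (Q ^ 4)%N x <= (Q ^ 3)%:R * pi ^+ 2 ->
  #|near_tuples d (Q ^ 4) x|%:R <= pi ^+ d / q%:R ^+ d.
Proof.
move=> leT; rewrite card_near_tuples; set r := #|_|.
have le_r : (q * r <= #|I|)%N.
  have := near_one_energy hc u x (tolerance_le (Q ^ 4)); rewrite -/r -/T -/pi.
  have Q3 : 1 <= (Q ^ 3)%:R :> algC by rewrite ler1n expn_gt0 Q_gt0.
  have pi0 : 0 <= pi ^+ 2 by rewrite exprn_ge0 ?ler0n.
  move=> h; have {}h := le_trans h (ler_wpM2l (ler0n _ 4) (lerD (ler_peMl pi0 Q3)
     (ler_wpM2l (ler0n _ 2) leT))).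
  move: h; rewrite /pi -!natrX -!natrM -!natrD -!natrM ler_nat.
  have -> : (4 * (Q ^ 3 * #|I| ^ 2 + 2 * (Q ^ 3 * #|I| ^ 2)) =
     Q ^ 3 * (12 * #|I| ^ 2))%N by lia.
  rewrite expnSr -mulnA leq_pmul2l ?expn_gt0 ?Q_gt0 // => h.
  have := leq_trans (leq_mul le_q (leqnn _)) h.
  by rewrite -mulnA leq_pmul2l // -expnMn leq_exp2r.
rewrite ler_pdivlMr ?exprn_gt0 ?ltr0n // /pi -!natrX -natrM ler_nat -expnMn.
by rewrite mulnC; case: (d) => // d'; rewrite leq_exp2r.
Qed.

(** Of the [d] factors [r], exactly [2 D] are bounded through [K r^2 <= 12 T], the others trivially.
    Since [D = k (m + 4)], [T^D] splits into [T^(4k)], summed over [x] by [coprime_moment], and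
    [(T^k)^m], bounded for each [x] separately. *)
Lemma card_near_tuples_large K : (Q ^ 2 <= K)%N ->
  \sum_(x | large K x) #|near_tuples d K x|%:R <= pi ^+ d * (Q%:R ^+ 4 / Q%:R ^+ m).
Proof.
move=> le_K; have K_gt0 : (0 < K)%N by apply: leq_trans le_K; rewrite expn_gt0 Q_gt0.
have K0 : 0 < K%:R :> algC by rewrite ltr0n.
have V0 : 0 <= V by apply: ler0n.
pose D := (k * (m + 4))%N.
have pi0 : 0 <= pi by apply: ler0n.
have T0 x : 0 <= T K x by apply: power_energy_ge0.
pose B := pi ^+ (d - 2 * D) * 12 ^+ D / K%:R ^+ (4 * k) * (V / K%:R) ^+ m.
have B0 : 0 <= B by rewrite !(mulr_ge0, exprn_ge0, invr_ge0) // ?ler0n // ltW.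
apply: (@le_trans _ _ (\sum_(x | energy_maximal c u K x) B * T K x ^+ (4 * k))).
  rewrite [leRHS]big_mkcond [leLHS]big_mkcond; apply: ler_sum => x _.
  case: ifPn => [/and3P[-> piT Tk]|_]; last first.
    by case: ifP => // _; rewrite mulr_ge0 ?exprn_ge0.
  rewrite card_near_tuples; set r := #|_|.
  have le_r : K%:R * r%:R ^+ 2 <= 12 * T K x.
    apply: le_trans (near_one_energy hc u x (tolerance_le K)) _.
    have -> : 12 * T K x = 4 * (T K x + 2 * T K x) by ring.
    by rewrite ler_wpM2l // lerD2r.
  have le_rpi : r%:R <= pi by rewrite ler_nat max_card.
  rewrite natrX -[d in leLHS](subnK le_d) -/D exprD.
  rewrite /B -!mulrA; apply: ler_pM; rewrite ?exprn_ge0 ?ler0n //.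
    by rewrite lerXn2r ?nnegrE ?ler0n.
  have KD : K%:R ^+ D = K%:R ^+ (4 * k) * K%:R ^+ m * K%:R ^+ (k.-1 * m) :> algC.
    rewrite -!exprD; congr (_ ^+ _); rewrite /D; case: (k) k_gt0 => // k' _.
    by clear; lia.
  have : (K%:R * r%:R ^+ 2) ^+ D <= (12 * T K x) ^+ D.
    by rewrite lerXn2r ?nnegrE ?mulr_ge0 ?exprn_ge0 ?ler0n.
  rewrite exprMn [leRHS]exprMn -exprM => h.
  rewrite -(ler_pM2l (exprn_gt0 D K0)); apply: le_trans h _.
  have TD : T K x ^+ D = T K x ^+ (4 * k) * (T K x ^+ k) ^+ m.
    by rewrite -exprM -exprD; congr (_ ^+ _); rewrite /D; clear; lia.
  rewrite TD [leRHS]mulrCA ler_wpM2l ?exprn_ge0 //.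
  have -> : K%:R ^+ D * ((K%:R ^+ (4 * k))^-1 * ((V / K%:R) ^+ m * T K x ^+ (4 * k)))
     = T K x ^+ (4 * k) * (K%:R ^+ k.-1 * V) ^+ m.
    rewrite KD [in RHS]exprMn -exprM expr_div_n.
    by field; rewrite !expf_neq0 // gt_eqF.
  rewrite ler_wpM2l ?exprn_ge0 // lerXn2r ?nnegrE ?exprn_ge0 //.
  by rewrite mulr_ge0 ?exprn_ge0 // ltW.
rewrite -mulr_sumr.
apply: le_trans (ler_wpM2l B0 (coprime_moment hc k_gt0 momentV K)) _.
have -> : B * (4 ^+ k * K%:R ^+ (4 * k) * V ^+ 4) =
    pi ^+ (d - 2 * D) * 12 ^+ D * 4 ^+ k * V ^+ (m + 4) / K%:R ^+ m.
  by rewrite /B expr_div_n exprD; field; rewrite !expf_neq0 // gt_eqF.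
have -> : pi ^+ (d - 2 * D) * 12 ^+ D * 4 ^+ k * V ^+ (m + 4) / K%:R ^+ m =
   pi ^+ d * (12 ^+ D * 4 ^+ k * v%:R ^+ (m + 4) / K%:R ^+ m).
  rewrite /V natrM natrX -/pi exprMn -exprM.
  have -> : (2 * k * (m + 4) = 2 * D)%N by rewrite /D; lia.
  by rewrite -[d in RHS](subnK le_d) -/D [pi ^+ (_ + _)]exprD; ring.
rewrite ler_wpM2l ?exprn_ge0 //.
have Q0 : 0 < Q%:R :> algC by rewrite ltr0n.
rewrite ler_pdivlMr ?exprn_gt0 // mulrAC ler_pdivrMr ?exprn_gt0 //.
rewrite -!natrX -!natrM ler_nat.
(* The 48 in [le_Q] is 12 from the Fejer bound times 4 from [coprime_energy]. *)
have h1 : (12 ^ D * 4 ^ k * v ^ (m + 4) <= Q ^ (m + 4))%N.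
  apply: (@leq_trans ((48 ^ k * v) ^ (m + 4))); last first.
    by rewrite leq_exp2r // addn4.
  rewrite expnMn leq_mul2r; apply/orP; right.
  rewrite -[48%N]/(12 * 4)%N expnMn expnMn -!expnM leq_mul2l; apply/orP; right.
  by rewrite leq_exp2l // leq_pmulr // addn4.
have h2 : (Q ^ m * Q ^ m <= K ^ m)%N.
  by rewrite -expnMn mulnn; case: (m) => // m'; rewrite leq_exp2r.
apply: leq_trans (leq_mul h1 (leqnn _)) _.
by rewrite addnC expnD -mulnA leq_mul2l h2 orbT.
Qed.

(** When the energy at scale [Q ^ 4] exceeds the threshold, a maximal dilation [g] is taken. The
    scale [K] stays above [Q ^ 2], so [g <= Q ^ 2] and the dilated energy is still at least the
    diagonal term. *)
Lemma bad_tuple_cases f : f \in bad_tuples d (Q ^ 4) ->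
  (exists2 x, T (Q ^ 4)%N x <= (Q ^ 3)%:R * pi ^+ 2 & f \in near_tuples d (Q ^ 4) x)
  \/ (exists2 K, (Q ^ 2 <= K <= Q ^ 4)%N &
        exists2 x, large K x & f \in near_tuples d K x).
Proof.
have Q0 : 0 < Q%:R :> algC by rewrite ltr0n.
have pi0 : 0 < pi by rewrite ltr0n.
case/bigcupP => x ord_x xf.
have T0 K y : 0 <= T K y by apply: power_energy_ge0.
have TR K y : T K y \is Num.real by apply: ger0_real.
have QR : (Q ^ 3)%:R * pi ^+ 2 \is Num.real.
  by rewrite ger0_real // mulr_ge0 ?ler0n ?exprn_ge0 // ltW.
case: (real_leP (TR (Q ^ 4)%N x) QR) => [le_T|lt_T]; first by left; exists x.
right; have [g g0 [maxg le_Tg]] := energy_maximal_exists c u (Q ^ 4) x.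
set K := (Q ^ 4 %/ g)%N in maxg le_Tg *; set y := (x ^+ g)%g in maxg le_Tg *.
have Kg : (K * g <= Q ^ 4)%N by apply: leq_trunc_div.
have lt_Tg : (Q ^ 6)%:R * pi ^+ 4 < g%:R * T K y ^+ 2.
  apply: lt_le_trans le_Tg.
  have -> : (Q ^ 6)%:R * pi ^+ 4 = ((Q ^ 3)%:R * pi ^+ 2) ^+ 2.
    by rewrite [RHS]exprMn -[pi ^+ 2 ^+ 2]exprM -[(Q ^ 3)%:R ^+ 2]natrX -expnM.
  rewrite ltrXn2r // ?nnegrE //.
  by rewrite mulr_ge0 ?ler0n ?exprn_ge0 // ltW.
(* The trivial bound [T <= K pi^2] gives [Q^6 < g K^2 <= Q^4 K]. *)
have lt_K : (Q ^ 2 < K)%N.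
  have : (Q ^ 6)%:R * pi ^+ 4 < g%:R * (K%:R * pi ^+ 2) ^+ 2.
    apply: lt_le_trans lt_Tg _; rewrite ler_wpM2l ?ler0n //.
    rewrite lerXn2r ?nnegrE ?mulr_ge0 ?ler0n ?exprn_ge0 ?(ltW pi0) //.
    exact: (power_energy_le hc u K y).
  rewrite exprMn -exprM -[(2 * 2)%N]/4%N [g%:R * (_ * _)]mulrA.
  rewrite ltr_pM2r ?exprn_gt0 // -natrX -natrM ltr_nat.
  rewrite -mulnn mulnA [(g * K)%N]mulnC => h.
  have := leq_trans h (leq_mul Kg (leqnn K)).
  by rewrite -[6%N]/(4 + 2)%N expnD ltn_pmul2l // expn_gt0 Q_gt0.
have K0 : (0 < K)%N by apply: leq_trans lt_K.
exists K; first by rewrite (ltnW lt_K) leq_div.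
exists y; last exact: (subsetP (near_tuples_exp d x K0)).
apply/and3P; split=> //.
  have le_g : (g <= Q ^ 2)%N.
    rewrite -(@leq_pmul2l (Q ^ 2)) ?expn_gt0 ?Q_gt0 // -expnD.
    by apply: leq_trans Kg; rewrite leq_mul2r (ltnW lt_K) orbT.
  rewrite -(@ler_pXn2r _ 2) // ?nnegrE ?exprn_ge0 // ?(ltW pi0) // -exprM.
  have Q2 : 0 < (Q ^ 2)%:R :> algC by rewrite ltr0n expn_gt0 Q_gt0.
  rewrite -(ler_pM2l Q2).
  apply: le_trans (_ : g%:R * T K y ^+ 2 <= _); last first.
    by rewrite ler_wpM2r ?exprn_ge0 // ler_nat.
  apply: le_trans (ltW lt_Tg).
  by rewrite ler_wpM2r ?exprn_ge0 ?(ltW pi0) // ler_nat leq_pexp2l.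
(* The exponents [g * j] with [1 <= j <= K] do not exceed [Q ^ 4], which is below the order of [x],
   so these powers are distinct. *)
apply: distinct_powers_energy k_gt0 momentV _ _ _ => i j.
rewrite -!expgM => /eqP; rewrite eq_expg_mod_order => /eqP.
have lt_ord (l : 'I_K) : (g * l.+1 < #[x]%g)%N.
  apply: leq_ltn_trans ord_x; apply: leq_trans Kg.
  by rewrite mulnC leq_mul2r ltn_ord orbT.
rewrite !modn_small // => /eqP; rewrite eqn_pmul2l // => /eqP[ij].
exact: val_inj.
Qed.

(* The two terms account for the characters of small and of large energy. *)
Lemma card_bad_tuples :
  #|bad_tuples d (Q ^ 4)|%:R <=
  pi ^+ d * (#|gT|%:R / q%:R ^+ d + Q%:R ^+ 8 / Q%:R ^+ m).
Proof.
have pi0 : 0 <= pi by apply: ler0n.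
have Q0 : 0 < Q%:R :> algC by rewrite ltr0n.
pose small x := T (Q ^ 4)%N x <= (Q ^ 3)%:R * pi ^+ 2.
(* An index [K] stands for the scale [K.+1]. There are at most [Q ^ 4] scales, which raises
   [Q^4 / Q^m] to [Q^8 / Q^m]. *)
pose Ks : pred 'I_(Q ^ 4) := fun K => (Q ^ 2 <= K.+1)%N.
apply: (@le_trans _ _ (\sum_(x | small x) #|near_tuples d (Q ^ 4) x|%:R +
    \sum_(K : 'I_(Q ^ 4) | Ks K)
       \sum_(x | large K.+1 x) #|near_tuples d K.+1 x|%:R)).
  rewrite -natr_sum; under [X in _ + X]eq_bigr => K _ do rewrite -natr_sum.
  rewrite -natr_sum -natrD ler_nat.
  pose B1 := \bigcup_(x | small x) near_tuples d (Q ^ 4) x.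
  pose B2 (K : 'I_(Q ^ 4)) := \bigcup_(x | large K.+1 x) near_tuples d K.+1 x.
  have sub : bad_tuples d (Q ^ 4) \subset B1 :|: \bigcup_(K | Ks K) B2 K.
    apply/subsetP => f /bad_tuple_cases[[x sx xf]|[K /andP[K1 K2] [x lx xf]]].
      by rewrite inE; apply/orP; left; apply/bigcupP; exists x.
    have K0 : (0 < K)%N by apply: leq_trans K1; rewrite expn_gt0 Q_gt0.
    rewrite inE; apply/orP; right; apply/bigcupP.
    have KP : (K.-1 < Q ^ 4)%N by rewrite prednK.
    exists (Ordinal KP); first by rewrite /Ks /= prednK.
    by apply/bigcupP; exists x; rewrite /= prednK.
  have cardU (J : finType) (P : pred J) (F : J -> {set {ffun 'I_d -> I}}) :
      (#|\bigcup_(j | P j) F j| <= \sum_(j | P j) #|F j|)%N.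
    elim/big_rec2: _ => [|j n S _ IH]; first by rewrite cards0.
    by apply: leq_trans (leq_card_setU _ _) _; rewrite leq_add2l.
  apply: leq_trans (subset_leq_card sub) _.
  apply: leq_trans (leq_card_setU _ _) _; apply: leq_add; first exact: cardU.
  by apply: leq_trans (cardU _ _ _) _; apply: leq_sum => K _; apply: cardU.
rewrite mulrDr; apply: lerD.
  apply: (@le_trans _ _ (\sum_(x : lT) pi ^+ d / q%:R ^+ d)).
    rewrite big_mkcond; apply: ler_sum => x _; case: ifP => [|_].
      exact: card_near_tuples_small.
    by rewrite divr_ge0 ?exprn_ge0 ?ler0n.
  by rewrite sumr_const card_pairing -[_ *+ _]mulr_natl mulrCA.
apply: (@le_trans _ _ (\sum_(K : 'I_(Q ^ 4)) pi ^+ d * (Q%:R ^+ 4 / Q%:R ^+ m))).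
  rewrite big_mkcond; apply: ler_sum => K _; case: ifP => [|_].
    exact: card_near_tuples_large.
  by rewrite mulr_ge0 ?divr_ge0 ?exprn_ge0 ?(ltW Q0).
rewrite sumr_const card_ord -[_ *+ _]mulr_natl natrX.
by rewrite [Q%:R ^+ 8](exprD _ 4 4) le_eqVlt; apply/orP; left; apply/eqP; ring.
Qed.

End Count.

End BadTuples.

(** * Covering by short products *)

Section Covering.

Context (lT gT : finGroupType) (c : lT -> gT -> algC) (hc : dual_pairing c).

(** If the value is not 1, its powers sum to 0 over a full period [#[x]], against the lower bound
    [#[x] / 2] of [sum_exp_near1]. *)
Lemma near_one_small_order K x g : (#[x]%g <= K)%N ->
  `|c x g - 1| <= tolerance K -> c x g = 1.
Proof.
move=> ordK near; have tol0 := le_trans (normr_ge0 _) near.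
have [//|z1] := eqVneq (c x g) 1.
have S0 : \sum_(a < #[x]%g) c x g ^+ a = 0.
  apply: (mulfI (_ : c x g - 1 != 0)); first by rewrite subr_eq0.
  by rewrite -subrX1 -(pairingXl hc) expg_order (pairing1l hc) subrr mulr0.
have near2 : `|c x g - 1| <= 2 * tolerance K.
  by apply: le_trans near _; rewrite ler_peMl // ler1n.
have small : 4 * #[x]%g%:R * tolerance K <= 1.
  apply: le_trans (tolerance_le K); rewrite ler_wpM2r // ler_wpM2l //.
  by rewrite ler_nat.
have := sum_exp_near1 (pairing_norm hc x g) near2 small.
by rewrite S0 normr0 ler_pdivrMr // mul0r (ler_nat _ _ 0) leqNgt order_gt0.
Qed.

Context (n : nat) (y : 'I_n -> gT) (K s E : nat).
Hypothesis K_gt0 : (0 < K)%N.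
Hypothesis E_gt0 : (0 < E)%N.
Hypothesis le_E : (#|gT| * (8 * K) ^ s < E ^ s)%N.
Hypothesis isolated : forall x, (forall i, `|c x (y i) - 1| <= tolerance K) ->
  forall i, c x (y i) = 1.

Let D x i := \sum_(a < E) c x (y i) ^+ a.

Lemma geometric_le x i : `|D x i| <= E%:R.
Proof.
apply: le_trans (ler_norm_sum _ _ _) _.
under eq_bigr => a _ do rewrite normrX (pairing_norm hc) expr1n.
by rewrite sumr_const card_ord.
Qed.

Lemma geometric_far x i :
  ~~ (`|c x (y i) - 1| <= tolerance K) -> `|D x i| <= (8 * K)%:R.
Proof.
have K0 : 0 < K%:R :> algC by rewrite ltr0n.
have tol0 : 0 < tolerance K by rewrite invr_gt0 mulr_gt0.
rewrite -real_ltNge ?normr_real ?ger0_real ?(ltW tol0) // => far.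
have : `|c x (y i) - 1| * `|D x i| <= 2.
  rewrite -normrM -subrX1; apply: le_trans (ler_normB _ _) _.
  by rewrite normrX (pairing_norm hc) expr1n normr1.
move/(le_trans (ler_wpM2r (normr_ge0 _) (ltW far))).
rewrite /tolerance ler_pdivrMl ?mulr_gt0 // => h; apply: le_trans h _.
by rewrite natrM le_eqVlt; apply/orP; left; apply/eqP; ring.
Qed.

(* Fourier inversion for the law of the product of [s] independent copies of
   [\prod_i y i ^+ a_i], the [a_i] being uniform in [0, E). *)
Lemma covering h :
  (forall x, (forall i, c x (y i) = 1) -> c x h = 1) ->
  exists e : 'I_n -> nat, (forall i, e i <= s * E)%N /\
    (\prod_i y i ^+ e i)%g = h.
Proof.
move=> hh; pose e (f : {ffun 'I_n * 'I_s -> 'I_E}) i := (\sum_t f (i, t))%N.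
have [f /eqP fP|nof] := pickP (fun f => (\prod_i y i ^+ e f i)%g == h).
  exists (e f); split=> // i; rewrite /e.
  rewrite -[X in (_ <= X * _)%N]card_ord -sum_nat_const; apply: leq_sum => t _.
  exact: ltnW.
exfalso.
pose G x := (c x h)^* * \prod_i D x i ^+ s.
have GE x : G x = \sum_f c x (h^-1 * \prod_i y i ^+ e f i)%g.
  rewrite /G (pairing_conj hc); under [RHS]eq_bigr do rewrite (pairingMr hc).
  rewrite -mulr_sumr; congr (_ * _).
  transitivity (\prod_(p : 'I_n * 'I_s) D x p.1).
    rewrite -(pair_bigA _ (fun i t => D x i)) /=; apply: eq_bigr => i _.
    by rewrite prodr_const card_ord.
  rewrite bigA_distr_bigA /=; apply: eq_bigr => f _; rewrite (pairing_prod hc).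
  transitivity (\prod_(p : 'I_n * 'I_s) c x (y p.1) ^+ f (p.1, p.2)).
    by apply: eq_bigr => -[].
  rewrite -(pair_bigA _ (fun i t => c x (y i) ^+ f (i, t))) /=.
  by apply: eq_bigr => i _; rewrite (pairingXr hc) prodrXr.
(* By orthogonality this sum counts the representations of [h], and none exists by assumption. *)
have sumG : \sum_x G x = 0.
  under eq_bigr do rewrite GE; rewrite exchange_big big1 //= => f _.
  by rewrite (pairing_sum hc) -eq_mulVg1 eq_sym nof muln0.
pose triv x := [forall i, c x (y i) == 1].
have Gtriv x : triv x -> G x = (E ^ (n * s))%:R.
  move=> /forallP xt; have x1 i : c x (y i) = 1 by apply/eqP.
  rewrite /G hh // conjC1 mul1r (eq_bigr (fun _ => E%:R ^+ s)).
    by rewrite prodr_const card_ord -exprM mulnC natrX.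
  move=> i _; rewrite /D; under eq_bigr do rewrite x1 expr1n.
  by rewrite sumr_const card_ord.
(* By isolation a nontrivial character is far from 1 on some [y i]; that single factor already saves
   [(8 K / E)^s], which beats the number of characters. *)
have Gntriv x : ~~ triv x -> `|G x| * (E ^ s)%:R <= (E ^ (n * s) * (8 * K) ^ s)%:R.
  move=> nt; have [i fari] : exists i, ~~ (`|c x (y i) - 1| <= tolerance K).
    apply/existsP; apply: contraR nt; rewrite negb_exists => /forallP near.
    apply/forallP => i; apply/eqP/isolated => j.
    by have := near j; rewrite negbK.
  rewrite /G normrM norm_conjC (pairing_norm hc) mul1r normr_prod (bigD1 i) //=.
  rewrite natrM mulrAC [leRHS]mulrC -mulrA; apply: ler_pM.
  - by rewrite normr_ge0.
  - by rewrite mulr_ge0 ?prodr_ge0.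
  - by rewrite normrX natrX lerXn2r ?nnegrE ?ler0n // geometric_far.
  have -> : (E ^ (n * s))%:R = \prod_(j < n) E%:R ^+ s :> algC.
    by rewrite prodr_const card_ord -exprM mulnC natrX.
  rewrite [leRHS](bigD1 i) //= natrX ler_wpM2l ?exprn_ge0 ?ler0n //.
  apply: ler_prod => j _; rewrite normr_ge0 normrX /=.
  by rewrite lerXn2r ?nnegrE ?ler0n // geometric_le.
have triv1 : triv 1%g by apply/forallP => i; rewrite (pairing1l hc).
pose S1 := \sum_(x | triv x) G x; pose S2 := \sum_(x | ~~ triv x) G x.
have S12 : S1 = - S2.
  by apply/eqP; rewrite -addr_eq0 -[X in _ == X]sumG [X in _ == X](bigID triv).
have le_S1 : (E ^ (n * s))%:R <= S1.
  rewrite /S1 (bigD1 1%g) //= Gtriv // lerDl sumr_ge0 // => x /andP[tx _].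
  by rewrite Gtriv ?ler0n.
have le_S2 : `|S2| * (E ^ s)%:R <= (#|gT| * (E ^ (n * s) * (8 * K) ^ s))%:R.
  apply: le_trans (ler_wpM2r (ler0n _ _) (ler_norm_sum _ _ _)) _.
  rewrite mulr_suml -(card_pairing hc) natrM mulr_natl -sumr_const big_mkcond.
  by apply: ler_sum => x _; case: ifPn => [/Gntriv|].
have: (E ^ (n * s))%:R * (E ^ s)%:R <= (#|gT| * (E ^ (n * s) * (8 * K) ^ s))%:R :> algC.
  apply: le_trans le_S2; rewrite ler_wpM2r ?ler0n //.
  by rewrite -normrN -S12 ger0_norm // (le_trans _ le_S1) ?ler0n.
rewrite -natrM ler_nat mulnCA leq_pmul2l ?expn_gt0 ?E_gt0 //.
by rewrite leqNgt le_E.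
Qed.

End Covering.

(** A character near 1 on all of [y] is near 1 on the good tuple [f], hence has order at most [K],
    and [near_one_small_order] applies. *)
Lemma not_bad_isolated (lT gT : finGroupType) (c : lT -> gT -> algC)
    (I : finType) (u : I -> gT) (d K n : nat) (f : {ffun 'I_d -> I})
    (y : 'I_n -> gT) (l : 'I_d -> 'I_n) :
  dual_pairing c -> f \notin bad_tuples c u d K -> (forall i, y (l i) = u (f i)) ->
  forall x, (forall i, `|c x (y i) - 1| <= tolerance K) ->
  forall i, c x (y i) = 1.
Proof.
move=> hc good yl x near i; apply: (near_one_small_order (K := K) hc) => //.
rewrite leqNgt; apply: contra good => ordK; apply/bigcupP; exists x => //.
by rewrite inE; apply/forallP => j; rewrite inE -yl.
Qed.

(** * Lattice bases *)

(** At a coordinate of largest modulus, a nonzero kernel vector would give [M <= n * W]. *)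
Lemma diag_dominant_det (n : nat) (M W : nat) (U : 'M[int]_n) :
  (forall i j, 0 <= U i j <= W%:Z) -> (n * W < M)%N ->
  \det (M%:Z%:M - U) != 0.
Proof.
move=> UW ltM; apply/det0P => -[v v0]; rewrite mulmxBr => /eqP; rewrite subr_eq0.
move=> /eqP eqv.
have [i vi] : exists i, v ord0 i != 0.
  apply/existsP; apply: contraR v0; rewrite negb_exists => /forallP v0.
  by apply/eqP/rowP => i; rewrite mxE; apply/eqP; move: (v0 i); rewrite negbK.
pose j := [arg max_(j > i) `|v ord0 j|%N].
have max_j k : (`|v ord0 k| <= `|v ord0 j|)%N.
  by rewrite /j; case: arg_maxnP => // j' _; apply.
have vj : (0 < `|v ord0 j|)%N by apply: leq_trans (max_j i); rewrite absz_gt0.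
have := congr1 (fun r : 'rV[int]_n => `|r ord0 j|) eqv.
rewrite mul_mx_scalar !mxE normrM => eqj.
have : M%:Z * `|v ord0 j| <= n%:Z * (`|v ord0 j| * W%:Z).
  rewrite -[M%:Z]ger0_norm // eqj; apply: le_trans (ler_norm_sum _ _ _) _.
  have -> : n%:Z * (`|v ord0 j| * W%:Z) = \sum_(k < n) `|v ord0 j| * W%:Z.
    by rewrite sumr_const card_ord -natz mulr_natl.
  apply: ler_sum => k _.
  rewrite normrM; apply: ler_pM => //; first by rewrite -!abszE lez_nat.
  by case/andP: (UW k j) => U0 leU; rewrite ger0_norm.
rewrite -abszE -!PoszM lez_nat mulnCA mulnC leq_pmul2l //.
by rewrite leqNgt ltM.
Qed.

Lemma int_span_closed (n m : nat) (L : 'rV[int]_n -> Prop) (V : 'M[int]_(m, n)) :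
  L 0 -> (forall v w, L v -> L w -> L (v - w)) -> (forall i, L (row i V)) ->
  forall a : 'rV[int]_m, L (a *m V).
Proof.
move=> L0 LB LV a.
have LN v : L v -> L (- v) by move=> Lv; rewrite -sub0r; apply: LB.
have LD v w : L v -> L w -> L (v + w) by move=> Lv Lw; rewrite -[w]opprK; apply/LB/LN.
have LZ (z : int) v : L v -> L (z *: v).
  move=> Lv; have LM k : L (k%:Z *: v).
    elim: k => [|k IHk]; first by rewrite scale0r.
    by rewrite -[k.+1]addn1 PoszD scalerDl scale1r; apply: LD.
  case: (intP z) => [|k|k]; [exact: LM 0%N|exact: LM|].
  by rewrite scaleNr; apply/LN/LM.
by rewrite mulmx_sum_row; elim/big_ind: _ => // i _; apply: LZ.
Qed.

Section Basis.

Context (n : nat) (L : 'rV[int]_n -> Prop) (V : 'M[int]_n) (M : nat).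
Hypothesis L0 : L 0.
Hypothesis LB : forall v w, L v -> L w -> L (v - w).
Hypothesis LV : forall i, L (row i V).
Hypothesis detV : \det V != 0.
Hypothesis le_V : forall i j, `|V i j| <= M%:Z.

(* Up to the factor [\det V], the coordinates of [v] on the rows of [V]. *)
Let crd (v : 'rV[int]_n) : 'rV[int]_n := v *m \adj V.

Let crdB v w : crd (v - w) = crd v - crd w. Proof. exact: mulmxBl. Qed.

Let crdK v : crd v *m V = \det V *: v.
Proof. by rewrite -mulmxA mul_adj_mx mul_mx_scalar. Qed.

Let crdV (a : 'rV[int]_n) : crd (a *m V) = \det V *: a.
Proof. by rewrite /crd -mulmxA mul_mx_adj mul_mx_scalar. Qed.

Let upto (i : nat) (v : 'rV[int]_n) := forall j : 'I_n, (i <= j)%N -> crd v ord0 j = 0.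

(** As in the Hermite normal form, [b] has the least positive [i]-th coordinate along the flag
    [upto]. A signed row of [V] shows that this is at most [|\det V|]; subtracting multiples of rows
    reduces the earlier coordinates modulo [\det V]. *)
Let minimal_vector (i : 'I_n) : exists b, [/\ L b, upto i.+1 b,
  0 < crd b ord0 i,
  (forall j, `|crd b ord0 j| <= `|\det V|) &
  forall v, L v -> upto i.+1 v -> 0 <= crd v ord0 i -> crd v ord0 i < crd b ord0 i ->
    crd v ord0 i = 0].
Proof.
pose P m := `[< exists v, [/\ L v, upto i.+1 v & crd v ord0 i = m.+1%:Z] >].
have detpos : (0 < `|\det V|)%N by rewrite absz_gt0.
have Pdet : P `|\det V|.-1%N.
  apply/asboolP; exists ((sgz (\det V) *: delta_mx ord0 i) *m V).
  split; first exact: int_span_closed.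
    move=> j ltij; rewrite crdV !mxE eqxx /=.
    by rewrite (_ : j == i = false) ?mulr0 //; apply/eqP => E; rewrite E ltnn in ltij.
  by rewrite crdV !mxE !eqxx mulr1 prednK // abszEsg mulrC.
have [m /asboolP[b0 [Lb0 ub0 cb0]] minm] := ex_minnP (ex_intro P _ Pdet).
pose a : 'rV[int]_n := \row_j (if (j < i)%N then (crd b0 ord0 j %/ \det V)%Z else 0).
have crdb j : crd (b0 - a *m V) ord0 j =
    if (j < i)%N then (crd b0 ord0 j %% \det V)%Z else crd b0 ord0 j.
  rewrite crdB crdV !mxE; case: ifP => _; last by rewrite mulr0 subr0.
  by rewrite /modz mulrC.
have crdbi : crd (b0 - a *m V) ord0 i = m.+1%:Z by rewrite crdb ltnn cb0.
exists (b0 - a *m V); split.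
- by apply: LB => //; apply: int_span_closed.
- by move=> j ltij; rewrite crdb ltnNge (ltnW ltij) /= ub0.
- by rewrite crdbi.
- move=> j; rewrite crdb; case: ltnP => [_|le_ij].
    by rewrite ger0_norm ?modz_ge0 // ltW // ltz_mod.
  have [->|ne_ij] := eqVneq j i; last first.
    by rewrite ub0 ?normr0 // ltn_neqAle le_ij andbT eq_sym.
  by rewrite cb0; have := minm _ Pdet; lia.
move=> v Lv uv v0; rewrite crdbi => ltv; apply/eqP; apply: contraTT ltv => vi.
rewrite -leNgt; have [k Dk] : exists k : nat, crd v ord0 i = k.+1%:Z.
  by exists (`|crd v ord0 i|.-1)%N; lia.
rewrite Dk lez_nat ltnS; apply: minm; apply/asboolP; exists v; split=> //.
Qed.

(** The minimal vectors have a triangular coordinate matrix, hence are independent, and they span by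
    division with remainder along the flag. Their coordinates are at most [|\det V|], so dividing by
    [\det V] leaves the bound [n * M] on the entries. *)
Lemma lattice_basis : exists B : 'M[int]_n,
  [/\ forall c : 'rV[int]_n, c *m B = 0 -> c = 0,
      forall v, L v <-> exists c : 'rV[int]_n, v = c *m B &
      forall i j, `|B i j| <= (n * M)%:Z].
Proof.
have [b bP] := choice minimal_vector.
pose B := \matrix_i b i; have rowB i : row i B = b i by rewrite rowK.
have LB' i : L (row i B) by rewrite rowB; case: (bP i).
pose Phi := B *m \adj V; have PhiE i j : Phi i j = crd (b i) ord0 j.
  by rewrite -rowB /crd -row_mul [RHS]mxE.
have detPhi : \det Phi != 0.
  rewrite det_trig.
    by apply/prodf_neq0 => i _; rewrite PhiE gt_eqF //; case: (bP i).
  by apply/is_trig_mxP => i j ltij; rewrite PhiE; case: (bP i) => _ ub _ _ _; apply: ub.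
exists B; split.
- move=> c cB; apply/eqP; apply: contraT => c0.
  case/negP: detPhi; apply/det0P; exists c => //.
  by rewrite mulmxA cB mul0mx.
- move=> v; split=> [Lv|[c ->]]; last exact: int_span_closed.
  suff: forall t w, (t <= n)%N -> L w -> upto t w -> exists c : 'rV_n, w = c *m B.
    by move/(_ n v (leqnn n) Lv); apply=> j; rewrite leqNgt ltn_ord.
  elim=> [|t IHt] w le_t Lw uw.
    exists 0; rewrite mul0mx; apply: (scalemx_inj detV).
    rewrite -crdK scaler0 (_ : crd w = 0) ?mul0mx //.
    by apply/rowP => j; rewrite uw // mxE.
  pose i := Ordinal le_t; have [Lb ub bi _ minb] := bP i.
  pose q := (crd w ord0 i %/ crd (b i) ord0 i)%Z.
  have qE : q *: b i = (q *: delta_mx ord0 i) *m B.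
    by rewrite -scalemxAl -rowE rowB.
  pose w' := w - q *: b i.
  have Lw' : L w' by apply: LB => //; rewrite qE; apply: int_span_closed.
  have crdw' j : crd w' ord0 j = crd w ord0 j - q * crd (b i) ord0 j.
    by rewrite crdB /crd -scalemxAl !mxE.
  have uw' : upto t.+1 w' by move=> j ltj; rewrite crdw' uw // (ub j) // mulr0 subr0.
  have crdi : crd w' ord0 i = (crd w ord0 i %% crd (b i) ord0 i)%Z by rewrite crdw'.
  have wi : crd w' ord0 i = 0.
    apply: minb => //; rewrite crdi ?modz_ge0 ?gt_eqF //.
    exact: ltz_pmod.
  have [|c Dc] := IHt w' (ltnW le_t) Lw'.
    move=> j; rewrite leq_eqVlt => /orP[/eqP E|]; last exact: uw'.
    by rewrite -wi; congr (crd w' ord0 _); apply: val_inj.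
  exists (c + q *: delta_mx ord0 i); rewrite mulmxDl -qE -Dc /w'.
  by rewrite subrK.
move=> i k; have [_ _ _ le_det _] := bP i.
have detpos : 0 < `|\det V| by rewrite normr_gt0.
rewrite -(ler_pM2l detpos) -normrM.
have -> : \det V * B i k = \sum_j crd (b i) ord0 j * V j k.
  have := congr1 (fun r : 'rV_n => r ord0 k) (crdK (b i)).
  by rewrite !mxE => ->; rewrite -rowB mxE.
apply: le_trans (ler_norm_sum _ _ _) _.
apply: (@le_trans _ _ (\sum_(j < n) `|\det V| * M%:Z)).
  by apply: ler_sum => j _; rewrite normrM ler_pM.
by rewrite sumr_const card_ord -[_ *+ n]mulr_natl natz PoszM mulrCA.
Qed.

End Basis.

(** * Relations among units *)

(** The product determines the tuple up to [k ^ k] choices, since every entry is one of the [k]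
    primes of a fixed factorisation. A residue class contains at most [X ^ k %/ N + 1] possible
    products. *)
Lemma card_prime_tuples (I : finType) (w : I -> nat) (k X N : nat)
    (S : {set {ffun 'I_k -> I}}) :
  injective w -> (forall i, prime (w i)) -> (forall i, w i <= X)%N -> (0 < N)%N ->
  {in S &, forall p q : {ffun 'I_k -> I},
     (\prod_t w (p t) = \prod_t w (q t) %[mod N])%N} ->
  (#|S| <= (X ^ k %/ N).+1 * k ^ k)%N.
Proof.
move=> w_inj w_pr w_le N0 Smod.
pose P (p : {ffun 'I_k -> I}) := (\prod_t w (p t))%N.
have P_le p : (P p <= X ^ k)%N.
  apply: leq_trans (_ : \prod_(t < k) X <= _)%N; first by apply: leq_prod.
  by rewrite prod_nat_const card_ord.
have P_lt p : (P p %/ N < (X ^ k %/ N).+1)%N by rewrite ltnS leq_div2r.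
pose Q p := Ordinal (P_lt p).
rewrite -sum1_card (partition_big Q xpredT) //=.
rewrite -[X in (_ <= X * _)%N]card_ord -sum_nat_const; apply: leq_sum => j _.
rewrite sum1dep_card; set F := [set _ | _].
have [->|[p0 p0F]] := set_0Vmem F; first by rewrite cards0.
pose A := [set p0 t | t in 'I_k].
have cardA : (#|A| <= k)%N by rewrite -[k in leqRHS]card_ord leq_imset_card.
apply: leq_trans (_ : #|A| ^ k <= _)%N; last first.
  by case: (k) cardA => // k' cardA; rewrite leq_exp2r.
rewrite -[k in leqRHS]card_ord -card_ffun_on; apply: subset_leq_card.
apply/subsetP => p pF; apply/ffun_onP => t.
have PP : P p = P p0.
  move: pF p0F; rewrite !inE => /andP[pS /eqP Qp] /andP[p0S /eqP Qp0].
  rewrite (divn_eq (P p) N) (divn_eq (P p0) N).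
  have -> := Smod p p0 pS p0S.
  by congr (_ * _ + _)%N; have := congr1 val Qp0; rewrite -Qp => /= ->.
have : (w (p t) %| P p0)%N by rewrite -PP /P (bigD1 t) //= dvdn_mulr.
rewrite /P; elim/big_ind: _ => [|a b ha hb|t' _].
- by rewrite Euclid_dvd1.
- by rewrite Euclid_dvdM // => /orP[].
by rewrite dvdn_prime2 // => /eqP/w_inj->; apply: imset_f.
Qed.

Section UnitLattice.

Context (R : finComUnitRingType) (n : nat) (y : 'I_n -> {unit R}).

Definition unit_relations (v : 'rV[int]_n) : Prop :=
  \prod_i val (y i) ^ v ord0 i = 1.

Let yU i : val (y i) \is a GRing.unit. Proof. exact: valP. Qed.

Lemma unit_relations0 : unit_relations 0.
Proof. by rewrite /unit_relations big1 // => i _; rewrite mxE expr0z. Qed.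

Lemma unit_relationsB v w :
  unit_relations v -> unit_relations w -> unit_relations (v - w).
Proof.
rewrite /unit_relations => v1 w1.
under eq_bigr => i _ do rewrite !mxE exprzDr // -invr_expz.
rewrite big_split /= v1 prodrV ?w1 ?invr1 ?mulr1 // => i _.
exact: unitrXz (yU i).
Qed.

Lemma val_unit_prod (F : 'I_n -> {unit R}) :
  val (\prod_i F i)%g = \prod_i val (F i).
Proof. exact: (big_morph _ (@FinRing.val_unitM _) (FinRing.val_unit1 _)). Qed.

(** Writing [y i ^+ M] with exponents at most [W] gives the relations [M e_i - u_i]. The choice
    [M = n * W + 1] is the least one ensuring diagonal dominance. *)
Lemma unit_relations_basis (W : nat) :
  (forall (a : nat) i, exists e : 'I_n -> nat,
     (forall j, e j <= W)%N /\ (\prod_j y j ^+ e j = y i ^+ a)%g) ->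
  exists B : 'M[int]_n,
  [/\ forall c : 'rV[int]_n, c *m B = 0 -> c = 0,
      forall v, unit_relations v <-> exists c : 'rV[int]_n, v = c *m B &
      forall i j, `|B i j| <= (n * (n * W).+1)%N%:Z].
Proof.
move=> cover; pose M := (n * W).+1.
have rep i : exists e : {ffun 'I_n -> nat}, (forall j, e j <= W)%N /\
    (\prod_j y j ^+ e j = y i ^+ M)%g.
  have [e [leW eE]] := cover M i; exists [ffun j => e j]; split=> [j|].
    by rewrite ffunE.
  by rewrite -eE; apply: eq_bigr => j _; rewrite ffunE.
have /fin_all_exists[e eP] := rep.
pose U : 'M[int]_n := \matrix_(i, j) (e i j)%:Z.
apply: (@lattice_basis n unit_relations (M%:Z%:M - U)).
- exact: unit_relations0.
- exact: unit_relationsB.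
- move=> i; rewrite /unit_relations.
  transitivity (\prod_j (val (y j) ^ ((if i == j then M else 0%N) : int) *
                         (val (y j) ^ (e i j : int))^-1)).
    apply: eq_bigr => j _; rewrite !mxE invr_expz -exprzDr //.
    by congr (_ ^ (_ - _)); case: eqP.
  rewrite big_split /= prodrV => [|j _]; last exact: unitrXz (yU j).
  have -> : \prod_j val (y j) ^ (e i j : int) = val (y i ^+ M)%g.
    have [_ <-] := eP i; rewrite val_unit_prod; apply: eq_bigr => j _.
    by rewrite FinRing.val_unitX exprnP.
  rewrite (bigD1 i) //= eqxx big1 => [|j]; last first.
    by rewrite eq_sym => /negPf->; rewrite expr0z.
  by rewrite mulr1 FinRing.val_unitX exprnP divrr //; apply: unitrXz (yU i).
- apply: (@diag_dominant_det _ _ W) => // i j; rewrite mxE.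
  by have [leW _] := eP i; rewrite lez_nat leW.
move=> i j; rewrite !mxE; have [leW _] := eP i; have := leW j.
have n0 : (0 < n)%N by apply: leq_ltn_trans (ltn_ord i).
rewrite /M; case: eqP => _ le_e; rewrite ?mulr1n ?mulr0n.
  by rewrite ger0_norm ?subr_ge0 ?lez_nat; nia.
by rewrite sub0r normrN; nia.
Qed.

End UnitLattice.

(** * Good tuples of primes modulo [N] *)

Section GoodTuples.

Context (d N : nat) (s : seq nat).
Hypothesis d_large : (2 ^ 12 <= d)%N.
Hypothesis N_gt2 : (2 < N)%N.
Hypothesis le_N : (N <= 3 ^ (d * d))%N.

Let X := (d ^ (1000 * d))%N.
Hypothesis mem_s : forall p, (p \in s) = [&& prime p, (p <= X)%N & ~~ (p %| N)%N].
Hypothesis uniq_s : uniq s.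

Let l := trunc_log 2 d.
Let k := (d %/ (500 * l)).+1.
Let Q := (3 ^ (5 * d))%N.
Let N_gt0 : (0 < N)%N. Proof. exact: ltnW (ltnW N_gt2). Qed.
Let N_gt1 : (1 < N)%N. Proof. exact: ltnW N_gt2. Qed.
Let d_gt0 : (0 < d)%N. Proof. by apply: leq_trans d_large; rewrite expn_gt0. Qed.

Let density : (X <= d ^ 3 * size s)%N.
Proof.
by apply: (primes_density d_large N_gt0 le_N) => p; rewrite mem_s => -> -> ->.
Qed.

Lemma size_primes_gt0 : (0 < size s)%N.
Proof.
have : (0 < X)%N by rewrite expn_gt0 d_gt0.
by move/leq_trans/(_ density); rewrite muln_gt0 => /andP[].
Qed.

(** The default value 1 is never taken for the [s] considered, as its primes do not divide [N]; see
    [val_prime_unit]. *)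
Definition prime_unit (i : seq_sub s) : {unit 'Z_N} :=
  insubd (1%g : {unit 'Z_N}) (ssval i)%:R.

Lemma val_prime_unit i : val (prime_unit i) = (ssval i)%:R.
Proof.
rewrite /prime_unit val_insubd unitZpE //.
have := ssvalP i; rewrite mem_s => /and3P[pr_i _ ndiv].
by rewrite coprime_sym prime_coprime // ndiv.
Qed.

Lemma card_unit_Zp_le : (#|{: {unit 'Z_N}}| <= N)%N.
Proof.
apply: leq_trans (leq_card _ (val_inj : injective (val : {unit 'Z_N} -> 'Z_N))) _.
by rewrite card_ord Zp_cast.
Qed.

Lemma card_prime_unit_fiber h :
  (#|[set p : {ffun 'I_k -> seq_sub s} |
       (\prod_(t < k) prime_unit (p t))%g == h]| <= (X ^ k %/ N).+1 * k ^ k)%N.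
Proof.
apply: (@card_prime_tuples _ (fun i : seq_sub s => ssval i)) => //.
- exact: val_inj.
- by move=> i; have := ssvalP i; rewrite mem_s => /and3P[].
- by move=> i; have := ssvalP i; rewrite mem_s => /and3P[].
have valP (p : {ffun 'I_k -> seq_sub s}) :
    val (\prod_(t < k) prime_unit (p t))%g = (\prod_t ssval (p t))%N%:R.
  rewrite val_unit_prod natr_prod; apply: eq_bigr => t _.
  exact: val_prime_unit.
move=> p q; rewrite !inE => /eqP hp /eqP hq.
have := congr1 (fun g : {unit 'Z_N} => nat_of_ord (val g)) (etrans hp (esym hq)).
by rewrite !valP !val_Zp_nat.
Qed.

Lemma good_tuples_exist : exists bad : {set {ffun 'I_d -> seq_sub s}},
  (#|bad| * d ^ d <= 2 * size s ^ d)%N /\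
  forall f, f \notin bad ->
  forall (n : nat) (y : 'I_n -> {unit 'Z_N}) (j : 'I_d -> 'I_n),
  (forall i, val (y (j i)) = (ssval (f i))%:R) ->
  exists B : 'M[int]_n,
  [/\ forall c : 'rV[int]_n, c *m B = 0 -> c = 0,
      forall v, unit_relations y v <-> exists c : 'rV[int]_n, v = c *m B &
      forall i j, `|B i j| <= (n * (n * (d * (8 * Q ^ 4 * 9 ^ d))).+1)%N%:Z].
Proof.
have abG : abelian [set: {unit 'Z_N}].
  apply/centsP => g _ h _; apply: val_inj.
  by rewrite !FinRing.val_unitM mulrC.
have [lT [c hc]] := dual_pairing_exists abG.
have cardI : #|{: seq_sub s}| = size s by rewrite card_seq_sub.
have Q_gt0 : (0 < Q)%N by rewrite expn_gt0.
have s_gt0 := size_primes_gt0.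
(* From [N <= X ^ k] one gets [N (X^k / N + 1) <= 2 X^k], and [density] trades [X] for [d^3] times
   the number of primes. *)
have le_v : (#|{: {unit 'Z_N}}| * ((X ^ k %/ N).+1 * k ^ k) <=
             2 * (k * d ^ 3) ^ k * #|{: seq_sub s}| ^ k)%N.
  rewrite cardI -[leqRHS]mulnA -expnMn [(k * d ^ 3)%N]mulnC mulnAC.
  apply: leq_trans (leq_mul card_unit_Zp_le (leqnn _)) _.
  rewrite expnMn !mulnA leq_mul2r; apply/orP; right.
  apply: leq_trans (_ : 2 * X ^ k <= _)%N; last first.
    by rewrite leq_mul2l leq_exp2r // density.
  rewrite mulnS mul2n -addnn; apply: leq_add; first exact: modulus_le_power.
  by rewrite mulnC leq_trunc_div.
have le_q := small_tuple_constant_le d_large.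
have le_d := moment_exponent_le d_large.
have le_Q := moment_constant_le d_large.
pose bad := bad_tuples c prime_unit d (Q ^ 4); exists bad; split.
  have I_gt0 : (0 < #|{: seq_sub s}|)%N by rewrite cardI.
  have q_gt0 : (0 < 9 ^ d)%N by rewrite expn_gt0.
  have := card_bad_tuples hc (isT : 0 < k)%N I_gt0 card_prime_unit_fiber le_v
    le_d le_q le_Q q_gt0.
  rewrite cardI -/bad => le_bad.
  suff : (#|bad| * d ^ d)%:R <= (2 * size s ^ d)%:R :> algC by rewrite ler_nat.
  rewrite natrM; apply: le_trans (ler_wpM2r (ler0n _ _) le_bad) _.
  rewrite natrM [(size s ^ d)%:R]natrX [leRHS]mulrC -mulrA.
  rewrite ler_wpM2l ?exprn_ge0 ?ler0n //.
  rewrite mulrDl -[2]/(1 + 1); apply: lerD.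
    rewrite mulrAC ler_pdivrMr ?exprn_gt0 ?ltr0n // mul1r -natrX -natrM ler_nat.
    (* The small-energy term: [#|gT| d^d <= 3^(d^2) 3^(d^2) = q^d]. *)
    have le_dd : (d ^ d <= 3 ^ (d * d))%N.
      by rewrite [(3 ^ _)%N]expnM leq_exp2r // ltnW // ltn_expl.
    apply: leq_trans (leq_mul (leq_trans card_unit_Zp_le le_N) le_dd) _.
    by rewrite -expnMn expnM.
  have Q0 : 0 < Q%:R :> algC by rewrite ltr0n.
  (* The large-energy term is [Q^8 / Q^(l+9) = Q^-(l+1)], at most [d^-d]. *)
  rewrite (_ : l + 9 = 8 + l.+1)%N; last by rewrite addnC addnS.
  rewrite exprD invfM mulrA divff ?expf_neq0 ?gt_eqF // mul1r mulrC.
  rewrite ler_pdivrMr ?exprn_gt0 // mul1r -natrX ler_nat /Q -expnM.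
  rewrite (_ : 5 * d * l.+1 = 5 * l.+1 * d)%N; last by rewrite mulnAC.
  by rewrite [leqRHS]expnM leq_exp2r // leq_expn3_trunc_log.
move=> f good n y j yj.
have yj' i : y (j i) = prime_unit (f i).
  by apply: val_inj; rewrite val_prime_unit.
have isolated := not_bad_isolated hc good yj'.
apply: unit_relations_basis => a i.
(* Covering is used with [s = d] and [E = 8 K 9^d], so that [E^d = (8 K)^d 9^(d^2)] exceeds
   [N (8 K)^d]. *)
apply: (covering hc (K := (Q ^ 4)%N)) => //.
- by rewrite expn_gt0 Q_gt0.
- by rewrite !muln_gt0 !expn_gt0.
- rewrite [ltnRHS]expnMn mulnC ltn_pmul2l; last first.
    by rewrite expn_gt0 muln_gt0 expn_gt0 Q_gt0.
  apply: leq_ltn_trans card_unit_Zp_le _; apply: leq_ltn_trans le_N _.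
  by rewrite -expnM ltn_exp2r ?muln_gt0 ?d_gt0.
by move=> x x1; rewrite (pairingXr hc) x1 expr1n.
Qed.

End GoodTuples.

(** * Probability *)

Require Import Defs.
From mathcomp Require Import all_classical all_reals all_analysis.

Import Order.TTheory GRing.Theory Num.Theory.
Import numFieldNormedType.Exports.

Local Open Scope classical_set_scope.
Local Open Scope ring_scope.

(** From [exp(-1/6) >= 5/6] follows [e <= (6/5)^6 < 3]. *)
Lemma expR1_le3 (R : realType) : expR 1 <= 3 :> R.
Proof.
have e6 : expR (1 / 6) <= 6 / 5 :> R.
  rewrite -[expR _]invrK -expRN; have h : 5 / 6 <= expR (- (1 / 6)) :> R.
    by apply: le_trans (expR_ge1Dx _); lra.
  apply: le_trans (_ : (5 / 6 : R)^-1 <= _); last by rewrite invf_div.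
  by rewrite lef_pV2 // posrE ?expR_gt0.
have -> : expR 1 = expR (1 / 6) ^+ 6 :> R.
  by rewrite -expRM_natl; congr expR; field.
apply: le_trans (_ : (6 / 5 : R) ^+ 6 <= _); last by lra.
by rewrite lerXn2r ?nnegrE ?expR_ge0.
Qed.

Lemma le_expn_dim (R : realType) (N : nat) : (0 < N)%N ->
  (N <= 3 ^ (dim_of R N * dim_of R N))%N.
Proof.
move=> N0; have N0' : 0 < N%:R :> R by rewrite ltr0n.
set d := dim_of R N.
have le_s : Num.sqrt (ln (N%:R : R)) <= d%:R.
  apply: le_trans (ceil_ge _) _; rewrite /d /dim_of natr_absz ler_int.
  exact: ler_norm.
have lnN0 : 0 <= ln (N%:R : R) by rewrite ln_ge0 // ler1n.
have le_ln : ln (N%:R : R) <= (d * d)%:R.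
  rewrite -(sqr_sqrtr lnN0) natrM -expr2.
  by rewrite lerXn2r ?nnegrE ?sqrtr_ge0 ?ler0n.
rewrite -(ler_nat R) -[leLHS](lnK N0'); apply: le_trans (_ : expR (d * d)%:R <= _).
  by rewrite ler_expR.
rewrite -[X in expR X]mulr1 expRM_natl natrX.
by rewrite lerXn2r ?nnegrE ?expR_ge0 // expR1_le3.
Qed.

Lemma euclidean_norm_row_le (R : realType) (m n b : nat) (B : 'M[int]_(m, n)) i :
  (forall i j, `|B i j| <= b%:Z) -> euclidean_norm R (row i B) <= (n * b)%:R.
Proof.
move=> leB; rewrite /euclidean_norm -[leRHS]ger0_norm ?ler0n // -sqrtr_sqr.
apply: ler_wsqrtr; apply: (@le_trans _ _ (\sum_(j < n) (b%:R : R) ^+ 2)).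
  apply: ler_sum => j _; rewrite mxE -[leLHS]ger0_norm ?sqr_ge0 // normrX.
  rewrite lerXn2r ?nnegrE ?ler0n // -intr_norm -[b%:R]/(b%:Z%:~R) ler_int.
  exact: leB.
rewrite sumr_const card_ord -[_ *+ n]mulr_natl natrM exprMn.
rewrite ler_wpM2r ?exprn_ge0 // -natrX ler_nat -mulnn.
by case: (n) => // n'; rewrite leq_pmulr.
Qed.

(** Origin of the exponent 42: [Q^4 9^d = 3^(22 d)], the polynomial factor [n^4] costs [3^(3 n)],
    and [3^5 <= 2^8] turns [3^(25 n)] into [2^(40 n)]. *)
Lemma basis_constant_le (d n : nat) : (0 < d)%N -> (d <= n)%N ->
  (n * (n * (n * (d * (8 * (3 ^ (5 * d)) ^ 4 * 9 ^ d))).+1) <= 16 * 2 ^ (42 * n))%N.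
Proof.
move=> d_gt0 le_dn; have n_gt0 : (0 < n)%N by apply: leq_trans le_dn.
have -> : (8 * (3 ^ (5 * d)) ^ 4 * 9 ^ d = 8 * 3 ^ (22 * d))%N.
  rewrite -mulnA -[9%N]/(3 ^ 2)%N -!expnM -expnD; congr (_ * 3 ^ _)%N; lia.
have le_E : (8 * 3 ^ (22 * d) <= 8 * 3 ^ (22 * n))%N.
  by rewrite leq_mul2l leq_pexp2l // leq_mul2l.
set E := (8 * 3 ^ (22 * n))%N in le_E.
have E_gt0 : (0 < E)%N by rewrite muln_gt0 expn_gt0.
apply: leq_trans (_ : n * (n * (2 * (n * (n * E)))) <= _)%N.
  rewrite !leq_mul2l; apply/orP; right; apply/orP; right.
  have : (n * (d * (8 * 3 ^ (22 * d))) <= n * (n * E))%N.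
    by rewrite leq_mul2l; apply/orP; right; apply: leq_mul.
  have : (0 < n * (n * E))%N by rewrite muln_gt0 n_gt0 muln_gt0 n_gt0 E_gt0.
  lia.
have n4 : (n * (n * (n * n)) <= 3 ^ (3 * n))%N.
  have n2 : (n <= 2 ^ n)%N by apply/ltnW/ltn_expl.
  apply: leq_trans (_ : 2 ^ n * (2 ^ n * (2 ^ n * 2 ^ n)) <= _)%N.
    by rewrite !leq_mul.
  by rewrite -!expnMn [leqRHS]expnM leq_exp2r.
have -> : (n * (n * (2 * (n * (n * E)))) = 16 * (n * (n * (n * n)) * 3 ^ (22 * n)))%N.
  by rewrite /E; set t := (3 ^ _)%N; lia.
rewrite leq_mul2l; apply/orP; right.
apply: leq_trans (leq_mul n4 (leqnn _)) _; rewrite -expnD.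
have -> : (3 * n + 22 * n = 5 * (5 * n))%N by lia.
apply: leq_trans (_ : 2 ^ (8 * (5 * n)) <= _)%N.
  by rewrite expnM [leqRHS]expnM leq_exp2r ?muln_gt0.
by rewrite leq_pexp2l //; lia.
Qed.

Lemma expn2_le_expR (R : realType) (n : nat) : (2 ^ n)%:R <= expR n%:R :> R.
Proof.
rewrite -[X in expR X]mulr1 expRM_natl natrX lerXn2r ?nnegrE ?expR_ge0 //.
by apply: le_trans (expR_ge1Dx _); rewrite -[2]/(1 + 1).
Qed.

Definition lattice_units (N d r : nat) (g : 'I_d -> {unit 'Z_N})
    (x : 'I_r -> {unit 'Z_N}) (i : 'I_(d + r)) : {unit 'Z_N} :=
  match fintype.split i with inl j => g j | inr j => x j end.

Lemma relation_latticeE (N d r : nat) (b : 'I_d -> nat) (g : 'I_d -> {unit 'Z_N})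
    (x : 'I_r -> {unit 'Z_N}) :
  (forall i, val (g i) = (b i)%:R) ->
  relation_lattice b x = [set v | unit_relations (lattice_units g x) v].
Proof.
move=> gb; rewrite /relation_lattice; apply/seteqP.
have E v : \prod_(i < d) ((b i)%:R : 'Z_N) ^ v ord0 (lshift r i) *
           \prod_(j < r) (val (x j) : 'Z_N) ^ v ord0 (rshift d j) =
           \prod_i val (lattice_units g x i) ^ v ord0 i.
  rewrite big_split_ord; apply: (congr2 *%R); apply: eq_bigr => i _.
    by rewrite /lattice_units (unsplitK (inl i)) gb.
  by rewrite /lattice_units (unsplitK (inr i)).
by split=> v /=; rewrite E.
Qed.

(** The lattice depends only on the residues of the [b i] and on the [x j], which take finitely many
    values; the event is a finite union of measurable cells. *)
Lemma measurable_lattice_event (R : realType) (disp : measure_display)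
    (T : measurableType disp) (P : probability T R) (N d r : nat)
    (b : 'I_d -> {RV P >-> nat}) (x : 'I_r -> {RV P >-> {unit 'Z_N}}) (M : R) :
  measurable [set w | has_basis_of_norm_le
     (relation_lattice (fun i => b i w) (fun j => x j w)) M].
Proof.
pose D : finType := ({ffun 'I_d -> 'Z_N} * {ffun 'I_r -> {unit 'Z_N}})%type.
pose phi w : D := ([ffun i => (b i w)%:R], [ffun j => x j w]).
pose L (z : D) : set 'rV[int]_(d + r) := [set v |
  \prod_(i < d) (z.1 i) ^ v ord0 (lshift r i) *
  \prod_(j < r) (val (z.2 j) : 'Z_N) ^ v ord0 (rshift d j) = 1].
have LE w : relation_lattice (fun i => b i w) (fun j => x j w) = L (phi w).
  have E v : \prod_(i < d) ((b i w)%:R : 'Z_N) ^ v ord0 (lshift r i) *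
             \prod_(j < r) (val (x j w) : 'Z_N) ^ v ord0 (rshift d j) =
             \prod_(i < d) ((phi w).1 i) ^ v ord0 (lshift r i) *
             \prod_(j < r) (val ((phi w).2 j) : 'Z_N) ^ v ord0 (rshift d j).
    by apply: (congr2 *%R); apply: eq_bigr => i _; rewrite ffunE.
  by apply/funext => v; rewrite /relation_lattice /L /mkset E.
pose F (z : D) := (\bigcap_(i in [set: 'I_d]) (b i @^-1` [set m | m%:R = z.1 i])) `&`
  (\bigcap_(j in [set: 'I_r]) (x j @^-1` [set z.2 j])).
rewrite (_ : mkset _ = \bigcup_(z in [set z | has_basis_of_norm_le (L z) M]) F z).
  apply: fin_bigcup_measurable => [|z _]; first exact: finite_finset.
  by apply: measurableI; apply: fin_bigcap_measurable => [|i _];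
    [exact: finite_finset|exact: measurable_funPTI|exact: finite_finset|
     exact: measurable_funPTI].
apply/seteqP; split=> w /=.
  by rewrite LE => Lw; exists (phi w) => //; split=> i _ /=; rewrite ffunE.
case=> z Lz [bz xz]; rewrite LE; suff -> : phi w = z by [].
case: z bz xz {Lz} => z1 z2 bz xz; congr (_, _); apply/ffunP => i; rewrite ffunE.
  exact: bz.
exact: xz.
Qed.

(** The events that [b] equals a given good tuple are disjoint, and independence gives each
    probability [(size s)^-d]. Nothing is asked of [W] where [b] leaves [s]. *)
Lemma probability_tuples_ge (R : realType) (disp : measure_display)
    (T : measurableType disp) (P : probability T R) (d : nat) (s : seq nat)
    (b : 'I_d -> {RV P >-> nat}) (bad : {set {ffun 'I_d -> seq_sub s}}) (W : set T) :
  (0 < size s)%N -> uniq s ->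
  (forall i, uniform_on (b i) s) -> mutually_independent b -> measurable W ->
  (forall w (f : {ffun 'I_d -> seq_sub s}), f \notin bad ->
     (forall i, b i w = ssval (f i)) -> W w) ->
  ((1 - #|bad|%:R / (size s)%:R ^+ d)%:E <= P W)%E.
Proof.
move=> s_gt0 uniq_s unif indep mW subW.
pose F (f : {ffun 'I_d -> seq_sub s}) :=
  \bigcap_(i in [set` [set: 'I_d]%SET]) (b i @^-1` [set ssval (f i)]).
have PF f : P (F f) = ((size s)%:R^-1 ^+ d)%:E.
  rewrite indep // (eq_bigr (fun=> ((size s)%:R^-1)%:E)) => [|i _].
    by rewrite prodEFin prodr_const cardsT card_ord.
  by rewrite unif ssvalP.
pose G : {set {ffun 'I_d -> seq_sub s}} := (~: bad)%SET.
have mF f : measurable (F f).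
  apply: fin_bigcap_measurable => [|i _]; first exact: finite_finset.
  exact: measurable_funPTI.
have PU : P (\bigcup_(f in [set` G]) F f) = (1 - #|bad|%:R / (size s)%:R ^+ d)%:E.
  rewrite measure_fin_bigcup //; last first.
    apply/trivIsetP => f g _ _; apply: contra_neqP => /eqP/set0P[w [fw gw]].
    apply/ffunP => i; apply: val_inj.
    have fwi : b i w = ssval (f i) by apply: fw; rewrite /= inE.
    by rewrite /= -fwi; apply: gw; rewrite /= inE.
  rewrite -(@bigfs _ _ _ _ (index_enum _)) ?index_enum_uniq //; last first.
    by move=> f _; rewrite mem_index_enum.
  rewrite (eq_bigr (fun=> ((size s)%:R^-1 ^+ d)%:E)) => [|f _]; last exact: PF.
  rewrite sumEFin sumr_const; congr EFin.
  have s0 : (size s)%:R != 0 :> R by rewrite pnatr_eq0 -lt0n.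
  rewrite -[LHS]mulr_natl.
  have -> : #|G|%:R = (size s)%:R ^+ d - #|bad|%:R :> R.
    rewrite -natrX; have := cardsC bad; rewrite -/G card_ffun card_seq_sub // card_ord.
    by move=> <-; rewrite natrD addrC addKr.
  by rewrite exprVn mulrBl divff // expf_neq0.
rewrite -PU; apply: le_measure; rewrite ?inE //.
  by apply: fin_bigcup_measurable => //; exact: finite_finset.
move=> w [f fG fw]; apply: (subW w f); first by move: fG; rewrite /= inE.
by move=> i; apply: fw; rewrite /= inE.
Qed.

Theorem theorem3p18 (R : realType) :
  exists C1 C2 : R, 0 < C1 /\ 0 < C2 /\
  forall N : nat, (2 < N)%N ->
  let d := dim_of R N in
  let X := (d ^ (1000 * d))%N in
  forall (disp : measure_display) (T : measurableType disp)
         (P : probability T R)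
         (b : 'I_d -> {RV P >-> nat}),
  (forall i, uniform_on (b i) (primes_upto_not_dvd N X)) ->
  mutually_independent b ->
  forall (r : nat) (x : 'I_r -> {RV P >-> {unit 'Z_N}}),
  (`| P [set w | has_basis_of_norm_le
                   (relation_lattice (fun i => b i w) (fun j => x j w))
                   (C2 * expR (42 * (d + r)%:R))] - 1 |
    <= (C1 * d%:R ^- d)%:E)%E.
Proof.
have [d0 d0E] : exists d0, d0 = (2 ^ 12)%N by eexists.
have d0_gt0 : (0 < d0)%N by rewrite d0E expn_gt0.
(* The summand [d0^d0] makes the claim trivial for [d < d0]; 2 comes from the count of bad tuples
   and 16 from [basis_constant_le]. *)
exists (2 + d0%:R ^+ d0), 16; split; first by rewrite ltr_pwDl ?exprn_ge0.
split=> // N N_gt2 d X disp T P b unif indep r x.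
set W := [set w | _].
have mW : measurable W by apply: measurable_lattice_event.
have N_gt0 : (0 < N)%N by apply: ltnW (ltnW N_gt2).
(* Otherwise [N <= 3^0 = 1]. *)
have d_gt0 : (0 < d)%N.
  have := le_expn_dim R N_gt0; rewrite -/d; case: (d) => //.
  by rewrite leqNgt (ltnW N_gt2).
have dR : 0 < d%:R ^+ d :> R by rewrite exprn_gt0 // ltr0n.
suff : ((1 - (2 + d0%:R ^+ d0) * d%:R ^- d)%:E <= P W)%E.
  have := probability_le1 P mW; have := fin_num_measure P W mW.
  move=> /fineK <-; rewrite -EFinB abse_EFin !lee_fin => p1 p2.
  by rewrite ler0_norm ?subr_le0 // opprB lerBlDr -lerBlDl.
have [lt_d|le_d] := ltnP d d0.
  apply: (@le_trans _ _ 0%E); last exact: measure_ge0.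
  rewrite lee_fin subr_le0 ler_pdivlMr // mul1r.
  apply: (@le_trans _ _ (d0%:R ^+ d0)); last by rewrite lerDr.
  rewrite -!natrX ler_nat (leq_trans (leq_pexp2l _ (ltnW lt_d))) //.
  by rewrite leq_exp2r // ltnW.
pose s := primes_upto_not_dvd N X.
have mem_s p : (p \in s) = [&& prime p, (p <= X)%N & ~~ (p %| N)%N].
  rewrite mem_filter mem_iota add0n ltnS leq0n -andbA; congr (_ && _).
  exact: andbC.
have uniq_s : uniq s by rewrite filter_uniq // iota_uniq.
have d_large : (2 ^ 12 <= d)%N by rewrite -d0E.
have le_N := le_expn_dim R N_gt0.
have [bad [le_bad good]] := good_tuples_exist d_large N_gt2 le_N mem_s uniq_s.
have s_gt0 := size_primes_gt0 d_large N_gt2 le_N mem_s.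
apply: le_trans (probability_tuples_ge s_gt0 uniq_s unif indep mW _); last first.
  move=> w f fgood bf; rewrite /W /=.
  pose g i := prime_unit N (f i).
  have gE i : val (g i) = (b i w)%:R by rewrite bf; apply: (val_prime_unit N_gt2 mem_s).
  rewrite (relation_latticeE (fun j => x j w) gE).
  have [] := good f fgood _ (lattice_units g (fun j => x j w)) (fun i => lshift r i).
    move=> i; rewrite /lattice_units (unsplitK (inl i)).
    exact: (val_prime_unit N_gt2 mem_s).
  move=> B [B_free B_span B_le]; exists (d + r)%N, B; split.
    split=> //; apply/seteqP; split=> v /=.
      by move/B_span => [c ->]; exists c.
    by case=> c _ <-; apply/B_span; exists c.
  move=> i; apply: le_trans (euclidean_norm_row_le R i B_le) _.
  apply: (@le_trans _ _ (16 * 2 ^ (42 * (d + r)))%N%:R).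
    by rewrite ler_nat basis_constant_le // leq_addr.
  rewrite natrM ler_wpM2l //; apply: le_trans (expn2_le_expR R _) _.
  by rewrite natrM.
rewrite lee_fin lerD2l lerN2.
have sR : 0 < (size s)%:R ^+ d :> R by rewrite exprn_gt0 // ltr0n.
apply: (@le_trans _ _ (2 * d%:R ^- d)); last first.
  by rewrite ler_wpM2r ?invr_ge0 ?(ltW dR) // lerDl exprn_ge0.
rewrite ler_pdivrMr // mulrAC ler_pdivlMr // -!natrX -!natrM ler_nat.
exact: le_bad.
Qed.
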